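(* Consider the dipole channel coefficient $h\in\mathbb{C}$ with fixed $\alpha\in\mathbb{C}\setminus\{0\}$, fixed $\kappa=kr>0$ and fixed unit vector $\mathbf{u}\in\mathbb{R}^3$, and with independent random orientations $\mathbf{o}_T,\mathbf{o}_R$, each uniformly distributed on the unit sphere of $\mathbb{R}^3$. Then the probability density function of $h$ (with respect to Lebesgue measure on $\mathbb{C}\cong\mathbb{R}^2$) is $$f(h)=\frac12\int_{-1}^{+1}f\!\left(h\,\middle|\,\mathbf{u}^{\mathsf T}\mathbf{o}_T=x\right)dx,$$ where $f(h\,|\,\mathbf{u}^{\mathsf T}\mathbf{o}_T=x)$ is the conditional density given explicitly in the context.
   Context: Dipole channel model: for unit vectors $\mathbf{o}_T,\mathbf{o}_R\in\mathbb{R}^3$ set $$\boldsymbol\beta_{NF}=\tfrac12(3\mathbf{u}\mathbf{u}^{\mathsf T}-\mathbf{I}_3)\mathbf{o}_T,\qquad \boldsymbol\beta_{FF}=(\mathbf{I}_3-\mathbf{u}\mathbf{u}^{\mathsf T})\mathbf{o}_T,$$ $$\mathbf{v}=\alpha\left(\left(\frac1{\kappa^3}+\frac{j}{\kappa^2}\right)\boldsymbol\beta_{NF}+\frac1{2\kappa}\boldsymbol\beta_{FF}\right)\in\mathbb{C}^3,\qquad h=\mathbf{o}_R^{\mathsf T}\mathbf{v},$$ where $j$ is the imaginary unit and $\mathbf{I}_3$ the identity matrix. Conditional density: let $\mathbf{v}_{\rm Re}=\mathrm{Re}(\mathbf{v})$, $\mathbf{v}_{\rm Im}=\mathrm{Im}(\mathbf{v})$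 (these are linearly independent whenever $\mathbf{u}^{\mathsf T}\mathbf{o}_T\notin\{0,1,-1\}$), $v_{\rm Re}=\|\mathbf{v}_{\rm Re}\|$, $v_{\rm Im}=\|\mathbf{v}_{\rm Im}\|$, $\rho=\mathbf{v}_{\rm Re}^{\mathsf T}\mathbf{v}_{\rm Im}/(v_{\rm Re}v_{\rm Im})$, and $$f(h\,|\,\mathbf{v})=\frac{1}{v_{\rm Re}v_{\rm Im}\sqrt{1-\rho^2}}\;\psi\!\left(\left\|\begin{bmatrix}1&0\\ \rho&\sqrt{1-\rho^2}\end{bmatrix}^{-1}\begin{bmatrix}\mathrm{Re}(h)/v_{\rm Re}\\ \mathrm{Im}(h)/v_{\rm Im}\end{bmatrix}\right\|^2\right),$$ with $\psi(x)=\frac{1}{2\pi\sqrt{1-x}}$ for $x\in[0,1)$ and $\psi(x)=0$ otherwise. For $x\in(-1,1)\setminus\{0\}$, $f(h\,|\,\mathbf{u}^{\mathsf T}\mathbf{o}_T=x)$ denotes $f(h\,|\,\mathbf{v})$ evaluated with the $\mathbf{v}$ belonging to any unit vector $\mathbf{o}_T$ with $\mathbf{u}^{\mathsf T}\mathbf{o}_T=x$; the value depends on $\mathbf{o}_T$ only through $x$. The exceptional values $x\in\{0,\pm1\}$ are irrelevant for the integral. *)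

(* Defs.v *)
From HB Require Import structures.
From mathcomp Require Import all_boot all_order all_algebra.
From mathcomp Require Import complex.
From mathcomp Require Import all_classical all_reals all_analysis.
From mathcomp Require Import measurable_realfun.
From mathcomp Require Import ring.

Set Implicit Arguments.
Unset Strict Implicit.
Unset Printing Implicit Defensive.

Import Order.TTheory GRing.Theory Num.Theory.

Local Open Scope classical_set_scope.
Local Open Scope ring_scope.
Local Open Scope complex_scope.

Definition dot (S : pzRingType) (n : nat) (a b : 'cV[S]_n) : S :=
  (a^T *m b) 0 0.

(* The library's norm on matrices is the max norm, hence this definition. *)
Definition enorm (R : rcfType) (n : nat) (a : 'cV[R]_n) : R :=
  Num.sqrt (dot a a).

(* Random vectors take values in R^3 seen as a product of Borel spaces, which
   carries the product sigma-algebra and the product Lebesgue measure;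
   [vec3] is the corresponding column vector. *)
Definition R3 (R : realType) :=
  (measurableTypeR R * measurableTypeR R * measurableTypeR R)%type.

Definition R2 (R : realType) := (measurableTypeR R * measurableTypeR R)%type.

Definition vec3 (R : realType) (p : R3 R) : 'cV[R]_3 :=
  \col_(i < 3) nth 0 [:: p.1.1; p.1.2; p.2] i.

Definition lebesgue3 (R : realType) : set (R3 R) -> \bar R :=
  ((lebesgue_measure \x lebesgue_measure) \x lebesgue_measure)%E.

(* Union of the half-open segments ]0, x] for x in A on the unit sphere. *)
Definition sphere_cone (R : realType) (A : set (R3 R)) : set (R3 R) :=
  [set y | exists r : R, exists x : R3 R,
    [/\ 0 < r <= 1, A x, enorm (vec3 x) = 1 & vec3 y = r *: vec3 x]].

(* Surface measure of the part of A lying on the unit sphere of R^3, defined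
   as n times the n-dimensional volume of the cone over it, with n = 3. *)
Definition sphere_measure (R : realType) (A : set (R3 R)) : \bar R :=
  (3%:E * lebesgue3 (sphere_cone A))%E.

Definition uniform_on_sphere d (T : measurableType d) (R : realType)
    (P : probability T R) (X : {RV P >-> R3 R}) : Prop :=
  forall A : set (R3 R), measurable A ->
    distribution P X A = (sphere_measure A / sphere_measure setT)%E.

Definition independent_RV d d1 d2 (T : measurableType d)
    (T1 : measurableType d1) (T2 : measurableType d2) (R : realType)
    (P : probability T R) (X : {RV P >-> T1}) (Y : {RV P >-> T2}) : Prop :=
  forall (A : set T1) (B : set T2), measurable A -> measurable B ->
    P (X @^-1` A `&` Y @^-1` B) = (P (X @^-1` A) * P (Y @^-1` B))%E.

Definition C_to_R2 (R : realType) (z : R[i]) : R2 R :=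
  (complex.Re z, complex.Im z).

Definition R2_to_C (R : realType) (p : R2 R) : R[i] := p.1 +i* p.2.

(* Z is a complex random variable with probability density function f with
   respect to Lebesgue measure on C = R^2. A density may be infinite on a
   null set, so f takes extended real values. *)
Definition has_density d (T : measurableType d) (R : realType)
    (P : probability T R) (Z : T -> R[i]) (f : R[i] -> \bar R) : Prop :=
  [/\ measurable_fun [set: T] (fun t => C_to_R2 (Z t)),
      measurable_fun [set: R2 R] (fun p => f (R2_to_C p)),
      forall z, (0 <= f z)%E
    & forall B : set (R2 R), measurable B ->
        P [set t | B (C_to_R2 (Z t))] =
        (\int[lebesgue_measure \x lebesgue_measure]_(p in B)
           f (R2_to_C p))%E].

Section Channel.
Context {R : realType}.
Variables (alpha : R[i]) (kappa : R) (u : 'cV[R]_3).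
Implicit Types (o : 'cV[R]_3) (v : 'cV[R[i]]_3).

Definition cplx_vec o : 'cV[R[i]]_3 := map_mx (real_complex R) o.
Definition re_vec v : 'cV[R]_3 := map_mx (@complex.Re R) v.
Definition im_vec v : 'cV[R]_3 := map_mx (@complex.Im R) v.

Definition beta_NF o : 'cV[R]_3 := 2^-1 *: ((3 *: (u *m u^T) - 1%:M) *m o).
Definition beta_FF o : 'cV[R]_3 := (1%:M - u *m u^T) *m o.

Definition channel_vec o : 'cV[R[i]]_3 :=
  alpha *:
    (((1 / kappa ^+ 3) +i* (1 / kappa ^+ 2)) *: cplx_vec (beta_NF o)
     + (1 / (2 * kappa))%:C *: cplx_vec (beta_FF o)).

Definition channel (oT oR : 'cV[R]_3) : R[i] :=
  dot (cplx_vec oR) (channel_vec oT).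

Definition psi (x : R) : R :=
  if 0 <= x < 1 then 1 / (2 * pi * Num.sqrt (1 - x)) else 0.

Definition cond_density (h : R[i]) v : R :=
  let vRe := enorm (re_vec v) in
  let vIm := enorm (im_vec v) in
  let rho := dot (re_vec v) (im_vec v) / (vRe * vIm) in
  let s := Num.sqrt (1 - rho ^+ 2) in
  let L : 'M[R]_(1 + 1) := block_mx 1%:M 0 rho%:M s%:M in
  let w : 'cV[R]_(1 + 1) :=
    col_mx (complex.Re h / vRe)%:M (complex.Im h / vIm)%:M in
  1 / (vRe * vIm * s) * psi (enorm (invmx L *m w) ^+ 2).

(* The conditional density given u^T oT = x is evaluated at some unit vector
   with that property; the choice is immaterial by [cond_density_atE]. *)
Definition cond_density_at (h : R[i]) (x : R) : R :=
  cond_density h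
    (channel_vec (xget 0 [set o | enorm o = 1 /\ dot u o = x])).

Lemma dot_lincomb (a b : 'cV[R]_3) (p q p' q' : R) :
  dot (p *: a + q *: b) (p' *: a + q' *: b) =
  p * p' * dot a a + (p * q' + q * p') * dot a b + q * q' * dot b b.
Proof.
by rewrite /dot !mxE !big_ord_recr !big_ord0 /= !mxE; ring.
Qed.

Lemma enorm1_dot o : enorm o = 1 -> dot o o = 1.
Proof.
move=> o1; have d0 : 0 <= dot o o.
  by rewrite /dot mxE sumr_ge0// => i _; rewrite mxE -expr2 sqr_ge0.
by rewrite -[LHS]sqr_sqrtr// -/(enorm o) o1 expr1n.
Qed.

Lemma re_vec_lincomb (a b : 'cV[R]_3) (p q : R[i]) :
  re_vec (p *: cplx_vec a + q *: cplx_vec b) =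
  complex.Re p *: a + complex.Re q *: b.
Proof.
by apply/matrixP => i j; rewrite !mxE; case: p q => [p1 p2] [q1 q2] /=; ring.
Qed.

Lemma im_vec_lincomb (a b : 'cV[R]_3) (p q : R[i]) :
  im_vec (p *: cplx_vec a + q *: cplx_vec b) =
  complex.Im p *: a + complex.Im q *: b.
Proof.
by apply/matrixP => i j; rewrite !mxE; case: p q => [p1 p2] [q1 q2] /=; ring.
Qed.

Lemma channel_vec_lincomb (x : R) : exists p q : R[i],
  forall o, dot u o = x -> channel_vec o = p *: cplx_vec u + q *: cplx_vec o.
Proof.
pose c : R[i] := (1 / kappa ^+ 3) +i* (1 / kappa ^+ 2).
pose e : R[i] := (1 / (2 * kappa))%:C.
exists (alpha * (c * (2^-1 * 3 * x)%:C - e * x%:C)).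
exists (alpha * (e - c * (2^-1)%:C)) => o ox.
have uo : u *m u^T *m o = x *: u.
  apply/matrixP => i j; rewrite -mulmxA !mxE big_ord1 (ord1 j) -ox /dot.
  by rewrite mulrC.
rewrite /channel_vec /beta_NF /beta_FF !mulmxBl -scalemxAl uo mul1mx -/c -/e.
apply/matrixP => i j; rewrite !mxE !(rmorphM, rmorphB) /=.
ring.
Qed.

Lemma eq_cond_density (h : R[i]) v w :
  dot (re_vec v) (re_vec v) = dot (re_vec w) (re_vec w) ->
  dot (re_vec v) (im_vec v) = dot (re_vec w) (im_vec w) ->
  dot (im_vec v) (im_vec v) = dot (im_vec w) (im_vec w) ->
  cond_density h v = cond_density h w.
Proof. by rewrite /cond_density ![enorm (_ _)]/enorm => -> -> ->. Qed.

Lemma cond_density_atE (h : R[i]) (x : R) o :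
  enorm u = 1 -> enorm o = 1 -> dot u o = x ->
  cond_density_at h x = cond_density h (channel_vec o).
Proof.
move=> u1 o1 uo; rewrite /cond_density_at; set w := xget _ _.
have [w1 uw] : enorm w = 1 /\ dot u w = x.
  by rewrite /w; case: xgetP => [y -> //|/(_ o)]; case.
move: w w1 uw => w /enorm1_dot w1 uw.
move/enorm1_dot: u1 => u1; move/enorm1_dot: o1 => o1.
have [p [q pq]] := channel_vec_lincomb x.
have gram : forall a b a' b' : R,
    dot (a *: u + b *: w) (a' *: u + b' *: w) =
    dot (a *: u + b *: o) (a' *: u + b' *: o).
  by move=> a b a' b'; rewrite !dot_lincomb u1 o1 w1 uo uw.
rewrite (pq _ uo) (pq _ uw).
by apply: eq_cond_density; rewrite ?re_vec_lincomb ?im_vec_lincomb; apply: gram.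
Qed.

End Channel.

(* Main.v *)
(** If [o] is uniform on the sphere, it has the law of [y / |y|] for [y] uniform
    in the unit ball. In the coordinates [y = (|z| t1, |z| t2, z)] Tonelli and the
    one-dimensional substitution [s = t / sqrt (1 + t^2)] show that [o.1] is
    uniform on [-1, 1] and that the first two coordinates of [o] have density
    [psi (|p|^2)] on the disk. Lebesgue measure on R^3 is invariant under linear
    isometries, so the same holds for the coordinates of [o] along any
    orthonormal pair; an affine change of variables in the plane then gives the
    law of [(vRe . o, vIm . o)]. By independence the law of [h] is the average of
    these conditional laws over [x = u . oT], which is uniform on [-1, 1]. *)

Require Import Defs.
From HB Require Import structures.
From mathcomp Require Import all_boot all_order all_algebra.
From mathcomp Require Import complex.
From mathcomp Require Import all_classical all_reals all_analysis.
From mathcomp Require Import measurable_realfun.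
From mathcomp Require Import ring.

Set Implicit Arguments.
Unset Strict Implicit.
Unset Printing Implicit Defensive.

Import Order.TTheory GRing.Theory Num.Theory.
Import numFieldNormedType.Exports.
Import HBNNSimple.

Local Open Scope classical_set_scope.
Local Open Scope ring_scope.
Local Open Scope complex_scope.

(** * Densities, image measures and measurability *)

(** Laws are compared through integrals of nonnegative functions, so Tonelli and one-variable
    substitutions replace every Jacobian in several variables. The coordinates are chosen for this:
    the norm of [(|z| t1, |z| t2, z)] is [|z| * hypot2 (t1, t2)], so [z] integrates out, and
    measuring [t1] in units of [hypot1 t2] splits the remaining weight into two factors. One is the
    derivative of [sin_atan], whence the uniform coordinate; the other is the Cauchy weight
    [(1 + y ^+ 2)^-1], which the same substitution turns into the inverse square root in [psi]. For
    isometries, determinants are avoided by averaging over translates of the unit ball, whose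
    indicator is invariant and whose volume is positive and finite. The explicit density requires
    independent real and imaginary parts of the channel vector. Their Gram determinant is
    [x^2 (1 - x^2) |alpha|^4 / (4 kappa^6)], so [alpha != 0] and [0 < kappa] confine the degeneracy
    to [x] in {0, 1, -1}, a null event for [u . oT]. *)

Lemma ge0_integral_density d (T : measurableType d) (R : realType)
    (m nu : {measure set T -> \bar R}) (w : T -> R) (f : T -> \bar R) :
  measurable_fun setT w -> (forall x, 0 <= w x) ->
  (forall A, measurable A -> nu A = \int[m]_(x in A) (w x)%:E)%E ->
  measurable_fun setT f -> (forall x, 0 <= f x)%E ->
  (\int[nu]_x f x = \int[m]_x (f x * (w x)%:E))%E.
Proof.
move=> mw w0 nuE mf f0.
pose f_ := nnsfun_approx measurableT mf.
have mfn n : measurable_fun setT (fun x => (f_ n x)%:E).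
  by apply/measurable_EFinP.
have mEw : measurable_fun setT (fun x => (w x)%:E) by apply/measurable_EFinP.
(* Both sides are limits along the increasing simple functions [f_ n], by monotone convergence; for
   a simple function the claim reduces to its level sets, where it is the hypothesis on [nu]. *)
transitivity (limn (fun n => \int[nu]_x (f_ n x)%:E)%E).
  rewrite -monotone_convergence//=.
  - apply: eq_integral => x _; apply/esym/cvg_lim => //=.
    exact: cvg_nnsfun_approx.
  - by move=> n x _; rewrite lee_fin.
  - by move=> x _ a b ab; rewrite lee_fin; exact/lefP/nd_nnsfun_approx.
transitivity (limn (fun n => \int[m]_x ((f_ n x)%:E * (w x)%:E))%E); last first.
  rewrite -monotone_convergence//=.
  - apply: eq_integral => x _; apply/cvg_lim => //=.
    apply: cvgeZr => //; exact: cvg_nnsfun_approx.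
  - by move=> n; apply: emeasurable_funM.
  - by move=> n x _; rewrite mule_ge0 ?lee_fin.
  - move=> x _ a b ab; rewrite lee_wpmul2r ?lee_fin//.
    exact/lefP/nd_nnsfun_approx.
congr (limn _); apply/funext => n.
have ge0 r x : (0 <= (r * \1_(f_ n @^-1` [set r]) x)%:E)%E.
  by rewrite EFinM nnfun_muleindic_ge0.
rewrite integralT_nnsfun sintegralE.
under [RHS]eq_integral => x _.
  rewrite fimfunE -fsumEFin// ge0_mule_fsuml; last by move=> r; exact: (ge0 r x).
  over.
rewrite ge0_integral_fsum//; last 2 first.
- move=> r; apply: emeasurable_funM => //; apply/measurable_EFinP/measurable_funM => //.
- by move=> r x _; rewrite mule_ge0 ?ge0 ?lee_fin.
apply: eq_fsbigr => r _.
have [r0|r0] := leP 0%R r; last first.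
  rewrite preimage_nnfun0// measure0 mule0 integral0_eq// => x _.
  by rewrite indic0 mulr0 mul0e.
rewrite nuE// integral_mkcond -ge0_integralZl//; last 2 first.
- by apply/(measurable_restrictT _ _).1 => //; apply: measurable_funTS.
- by move=> x _; rewrite erestrict_ge0// => y _; rewrite lee_fin.
apply: eq_integral => x _.
by rewrite epatch_indic/= EFinM -muleA; congr (_ * _)%E; rewrite muleC.
Qed.

(** The existential form yields, once destructed, a variable of measure type together with an
    equation, so that later rewriting meets an opaque [nu]. *)
Lemma image_measure_ex d d' (T1 : measurableType d) (T2 : measurableType d')
    (R : realType) (m : {measure set T1 -> \bar R}) (f : T1 -> T2) :
  measurable_fun setT f ->
  exists nu : {measure set T2 -> \bar R}, nu = pushforward m f :> (_ -> _).
Proof. by move=> mf; unshelve eexists; [refine (pushforward m f)|]. Qed.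

Lemma density_measure_ex d (T : measurableType d) (R : realType)
    (m : {measure set T -> \bar R}) (w : T -> R) :
  measurable_fun setT w -> (forall x, 0 <= w x) ->
  exists nu : {measure set T -> \bar R},
    forall A, nu A = (\int[m]_(x in A) (w x)%:E)%E.
Proof.
move=> mw w0; pose nu A := (\int[m]_(x in A) (w x)%:E)%E.
have nu0 : nu set0 = 0%E by rewrite /nu integral_set0.
have nu_ge0 A : (0 <= nu A)%E.
  by apply: integral_ge0 => x _; rewrite lee_fin.
have nuD : semi_sigma_additive nu.
  move=> F mF tF mUF; rewrite /nu; apply: cvg_toP.
    apply: ereal_nondecreasing_is_cvgn => p q pq.
    by apply: lee_sum_nneg_natr => // k _ _; exact: nu_ge0.
  rewrite ge0_integral_bigcup//=.
  - by apply/measurable_funTS/measurable_EFinP.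
  - by move=> x _; rewrite lee_fin.
pose mx := isMeasure.Build _ _ _ nu nu0 nu_ge0 nuD.
by exists (HB.pack_for {measure set T -> \bar R} nu mx).
Qed.

Section real_measurability.
Context {R : realType}.

Lemma invr_measurable : measurable_fun [set: R] (@GRing.inv R).
Proof.
have -> : [set: R] = ~` [set 0] `|` [set 0] by rewrite setUC setUv.
apply/measurable_funU => //; first exact: measurableC.
split; last exact: measurable_fun_set1.
apply: open_continuous_measurable_fun.
  exact/closed_openC/closed_eq.
by move=> x; rewrite inE => /eqP x0; exact: inv_continuous.
Qed.

Lemma sqrtr_measurable : measurable_fun [set: R] (@Num.sqrt R).
Proof. exact: continuous_measurable_fun (@sqrt_continuous R). Qed.

Lemma measurable_nat_of_bool d (T : measurableType d) (b : T -> bool) :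
  measurable_fun setT b -> measurable_fun setT (fun x => (b x)%:R : R).
Proof.
move=> mb; rewrite (_ : (fun x => (b x)%:R) = (fun x => if b x then 1 else 0)).
  by apply: measurable_fun_ifT.
by apply/funext => x; case: (b x).
Qed.

End real_measurability.

(* Structural measurability; dispatching on the syntax of the function keeps
   unification from unfolding the operations. *)
Ltac mfun := repeat lazymatch goal with
  | |- measurable_fun _ ?f => first
    [ assumption
    | lazymatch f with
      | (fun x => x) => exact: measurable_id
      | (fun _ => ?c) => exact: measurable_cst
      | fst => exact: measurable_fst
      | snd => exact: measurable_snd
      | (fun x => x.1) => exact: measurable_fst
      | (fun x => x.2) => exact: measurable_snd
      | (fun x => (@?g x).1) => apply: (measurableT_comp measurable_fst (g := g))
      | (fun x => (@?g x).2) => apply: (measurableT_comp measurable_snd (g := g))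
      | (fun x => (@?g x, @?h x)) => apply: (@measurable_fun_pair _ _ _ _ _ _ g h)
      | (fun x => (nat_of_bool (@?g x))%:R%R) => apply: (measurable_nat_of_bool (b := g))
      | (fun x => (@?g x && @?h x)) => apply: (measurable_and (f := g) (g := h))
      | (fun x => (@?g x < @?h x)%R) => apply: (measurable_fun_ltr (f := g) (g := h))
      | (fun x => (@?g x <= @?h x)%R) => apply: (measurable_fun_ler (f := g) (g := h))
      | (fun x => (@?g x - @?h x)%R) => apply: (measurable_funB (f := g) (g := h))
      | (fun x => (@?g x + @?h x)%R) => apply: (measurable_funD (f := g) (g := h))
      | (fun x => (@?g x * @?h x)%R) => apply: (measurable_funM (f := g) (g := h))
      | (fun x => (@?g x ^+ ?n)%R) => apply: (measurable_funX (f := g))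
      | (fun x => (- @?g x)%R) => apply: (measurable_funN (f := g))
      | (fun x => ((@?g x)^-1)%R) => apply: (measurableT_comp invr_measurable (g := g))
      | (fun x => Num.sqrt (@?g x)) => apply: (measurableT_comp sqrtr_measurable (g := g))
      | (fun x => @Num.norm _ _ (@?g x)) =>
          apply: (measurableT_comp (@normr_measurable _ setT) (g := g))
      | (fun x => (@?g x * @?h x)%E) => apply: (emeasurable_funM (f := g) (g := h))
      | (fun x => (@?g x)%:E) => apply: (measurable_EFinP _ g).2
      | (fun x => ?k (@?g x)) => match goal with H : measurable_fun setT ?k' |- _ =>
          unify k k'; apply: (measurableT_comp H (g := g)) end
      end ]
  end.

(** * One-dimensional substitutions *)

Section one_dim.
Context {R : realType}.
Local Notation mu := (@lebesgue_measure R).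

(** The intervals []a, b]] are stable under intersection and generate the Borel sets, and the
    intervals []-k, k]] exhaust the line with finite mass. *)
Lemma measure_itv_oc_unique (m1 m2 : {measure set (measurableTypeR R) -> \bar R}) :
  (forall a b, a < b -> m1 `]a, b]%classic = m2 `]a, b]%classic) ->
  (forall a b, (m1 `]a, b]%classic < +oo)%E) ->
  forall A, measurable A -> m1 A = m2 A.
Proof.
move=> m12 m1oo A mA.
refine (@measure_unique _ R (measurableTypeR R) (@ocitv R)
  (fun k : nat => `](- k%:R), k%:R]%classic) _ _ _ _ m1 m2 _ _ A mA) => //.
- exact: ocitvI.
- move=> k; exists (- k%:R, k%:R) => //.
- exact: bigcup_itvT.
- move=> X /ocitvP[->|[[a b] /= ab ->]]; first by rewrite !measure0.
  exact: m12.
Qed.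

(** Multiplied by [c], the image of Lebesgue measure under [c * x + d] gives every []a, b]] its
    length, hence is Lebesgue measure. *)
Lemma ge0_integral_affine (c d : R) (f : measurableTypeR R -> \bar R) : 0 < c ->
  measurable_fun setT f -> (forall x, 0 <= f x)%E ->
  (\int[mu]_x f (c * x + d)%R = (c^-1)%:E * \int[mu]_x f x)%E.
Proof.
move=> c0 mf f0; pose phi (x : measurableTypeR R) : measurableTypeR R := c * x + d.
have mphi : measurable_fun setT phi by rewrite /phi; mfun.
have [nu nuE] := image_measure_ex mu mphi.
have H : forall A, measurable A -> mu A = mscale (NngNum (ltW c0)) nu A.
  apply: measure_itv_oc_unique => /=.
  - move=> a b ab; rewrite /mscale/= nuE /pushforward.
    rewrite (_ : _ @^-1` _ = `]((a - d) / c), ((b - d) / c)]%classic); last first.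
      apply/seteqP; split => x /=; rewrite !in_itv/= ltr_pdivrMr// ler_pdivlMr//;
      by rewrite [x * c]mulrC ltrBlDr lerBrDr.
    rewrite lebesgue_measure_itv [X in (c%:E * X)%E]lebesgue_measure_itv/= !lte_fin.
    rewrite ltr_pM2r ?invr_gt0// ltrD2r ab.
    by rewrite -!EFinB -EFinM; congr _%:E; field; rewrite gt_eqF.
  - by move=> a b; rewrite lebesgue_measure_itv/=; case: ifP; rewrite ?ltry.
transitivity ((c^-1)%:E * \int[mscale (NngNum (ltW c0)) nu]_x f x)%E.
  rewrite ge0_integral_mscale// nuE ge0_integral_pushforward//=.
  by rewrite muleA -EFinM mulVf ?gt_eqF// mul1e preimage_setT.
congr (_ * _)%E; apply: eq_measure_integral => A mA _.
by rewrite [RHS]H.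
Qed.

Lemma integral_oneDsqrV : (\int[mu]_x ((1 + x ^+ 2)^-1)%:E = pi%:E)%E.
Proof.
have mf : measurable_fun setT (fun x : measurableTypeR R => ((1 + x ^+ 2)^-1)%:E) by mfun.
have f0 (x : R) : (0 <= ((1 + x ^+ 2)^-1)%:E)%E.
  by rewrite lee_fin invr_ge0 addr_ge0// sqr_ge0.
have h : (\int[mu]_(x in `[0%R, +oo[) ((1 + x ^+ 2)^-1)%:E = (pi / 2)%:E)%E.
  exact: integral0y_oneDsqr.
have h' : (\int[mu]_(x in `]-oo, 0%R]) ((1 + x ^+ 2)^-1)%:E = (pi / 2)%:E)%E.
  rewrite -h ge0_integration_by_substitution0//.
  by apply: eq_integral => x _; rewrite sqrrN.
rewrite -(setUv `]-oo, 0%R]%classic) ge0_integral_setU//=; last 3 first.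
- exact: measurableC.
- exact: measurable_funTS.
- exact/disj_setPCl.
rewrite h' setCitvl integral_itv_obnd_cbnd; last exact: measurable_funTS.
by rewrite h -EFinD; congr _%:E; field.
Qed.
End one_dim.

Section sin_atan_substitution.
Context {R : realType}.
Local Notation mu := (@lebesgue_measure R).

Definition hypot1 (t : R) : R := Num.sqrt (1 + t ^+ 2).

Definition sin_atan (t : R) : R := t / hypot1 t.

Lemma hypot1_gt0 t : 0 < hypot1 t.
Proof. by rewrite sqrtr_gt0 ltr_pwDl// sqr_ge0. Qed.

Lemma sqr_hypot1 t : hypot1 t ^+ 2 = 1 + t ^+ 2.
Proof. by rewrite sqr_sqrtr// addr_ge0// sqr_ge0. Qed.

Lemma measurable_hypot1 : measurable_fun [set: measurableTypeR R] hypot1.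
Proof. by rewrite /hypot1; mfun. Qed.

Lemma measurable_sin_atan : measurable_fun [set: measurableTypeR R] sin_atan.
Proof. by have mh := measurable_hypot1; rewrite /sin_atan; mfun. Qed.

Lemma subr_sqr_sin_atan t : 1 - sin_atan t ^+ 2 = hypot1 t ^- 2.
Proof.
have h0 : hypot1 t ^+ 2 != 0 by rewrite expf_neq0// gt_eqF// hypot1_gt0.
apply: (mulIf h0); rewrite mulVf// mulrBl mul1r /sin_atan expr_div_n divfK//.
by rewrite sqr_hypot1 addrK.
Qed.

Lemma sqrt_subr_sqr_sin_atan t : Num.sqrt (1 - sin_atan t ^+ 2) = (hypot1 t)^-1.
Proof.
by rewrite subr_sqr_sin_atan -exprVn sqrtr_sqr ger0_norm// invr_ge0 ltW// hypot1_gt0.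
Qed.

Lemma sin_atan_itv t : -1 < sin_atan t < 1.
Proof.
rewrite -ltr_norml -(ltr_pXn2r (n := 2))// ?nnegrE// ?expr1n//.
by rewrite real_normK ?num_real// -subr_gt0 subr_sqr_sin_atan invr_gt0 exprn_gt0// hypot1_gt0.
Qed.

Lemma sin_atanK s : -1 < s < 1 -> sin_atan (s / Num.sqrt (1 - s ^+ 2)) = s.
Proof.
move=> s1; have s0 : 0 < 1 - s ^+ 2.
  by rewrite subr_gt0 -real_normK ?num_real// expr_lt1// ltr_norml.
have q0 : 0 < Num.sqrt (1 - s ^+ 2) by rewrite sqrtr_gt0.
rewrite /sin_atan /hypot1 expr_div_n sqr_sqrtr ?ltW//.
rewrite (_ : 1 + s ^+ 2 / _ = (1 - s ^+ 2)^-1); last by field; rewrite gt_eqF.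
by rewrite sqrtrV ?ltW// invrK divfK// gt_eqF.
Qed.

Lemma is_derive_sin_atan (t : R) : is_derive t 1 sin_atan (hypot1 t ^- 3).
Proof.
have h0 := hypot1_gt0 t; have h2 := sqr_hypot1 t.
have p0 : 0 < 1 + t ^+ 2 by rewrite -h2 exprn_gt0.
have d1 : is_derive t 1 (fun y : R => 1 + y ^+ 2) (2 * t).
  by apply: is_derive_eq; rewrite add0r /GRing.scale/=; ring.
have d2 : is_derive t 1 hypot1 (t / hypot1 t).
  have dd := @is_derive1_comp R Num.sqrt (fun y : R => 1 + y ^+ 2) t _ _
    (is_derive1_sqrt p0) d1.
  apply: (is_derive_eq dd).
  rewrite -/(hypot1 t); by field; rewrite gt_eqF.
have d3 := is_deriveV (lt0r_neq0 h0) d2.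
apply: (is_derive_eq (is_deriveM (is_derive_id t (1 : R)) d3)).
rewrite /GRing.scale/=.
have e : hypot1 t ^+ 2 != 0 by rewrite expf_neq0// gt_eqF.
apply: (mulfI e).
rewrite -[RHS](_ : (hypot1 t)^-1 = _); last by field; rewrite gt_eqF.
transitivity ((hypot1 t ^+ 2 - t ^+ 2) / hypot1 t); first by field; rewrite gt_eqF.
by rewrite h2 addrK mul1r.
Qed.

Lemma continuous_sin_atan : continuous sin_atan.
Proof.
move=> t; apply/differentiable_continuous/derivable1_diffP.
exact: (@ex_derive _ _ _ _ _ _ _ (is_derive_sin_atan t)).
Qed.

Lemma sin_atan_lt : {mono sin_atan : x y / x < y}.
Proof.
apply: leW_mono; apply: le_mono => x y xy.
apply: (@gtr0_derive1_lt_cc R sin_atan x y _ _ _ x y) => //.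
- by move=> z _; exact: (@ex_derive _ _ _ _ _ _ _ (is_derive_sin_atan z)).
- move=> z _; rewrite derive1E (@derive_val _ _ _ _ _ _ _ (is_derive_sin_atan z)).
  by rewrite invr_gt0 exprn_gt0// hypot1_gt0.
- by apply: continuous_subspaceT; exact: continuous_sin_atan.
- by rewrite in_itv/= lexx ltW.
- by rewrite in_itv/= lexx ltW.
Qed.

Lemma integral_hypot1V3 (a b : R) : a < b ->
  (\int[mu]_(t in `]a, b]) (hypot1 t ^- 3)%:E = (sin_atan b - sin_atan a)%:E)%E.
Proof.
move=> ab; have mh := measurable_hypot1.
have mf : measurable_fun setT (fun t : measurableTypeR R => (hypot1 t ^- 3)%:E) by mfun.
rewrite integral_itv_obnd_cbnd; last exact: measurable_funTS.
rewrite (@continuous_FTC2 _ _ sin_atan)//.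
- apply: continuous_subspaceT => x.
  apply: cvgV; first by rewrite expf_neq0// gt_eqF// hypot1_gt0.
  apply: (@continuous_comp _ _ _ hypot1 (fun y => y ^+ 3)); last exact: exprn_continuous.
  apply: (@continuous_comp _ _ _ (fun y : R => 1 + y ^+ 2) Num.sqrt).
    by apply: cvgD; [exact: cvg_cst|exact: exprn_continuous].
  exact: sqrt_continuous.
- split.
  + by move=> z _; exact: (@ex_derive _ _ _ _ _ _ _ (is_derive_sin_atan z)).
  + by apply: cvg_at_right_filter; exact: continuous_sin_atan.
  + by apply: cvg_at_left_filter; exact: continuous_sin_atan.
- move=> z _; rewrite derive1E.
  exact: (@derive_val _ _ _ _ _ _ _ (is_derive_sin_atan z)).
Qed.

(** This is [ds = hypot1 t ^- 3 dt] for [s = sin_atan t], obtained by comparing measures: the one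
    with density [hypot1 ^- 3] and the image of Lebesgue measure on []-1, 1[] under the inverse map
    both give []a, b]] the mass [sin_atan b - sin_atan a]. *)
Lemma ge0_integral_sin_atan (f : measurableTypeR R -> \bar R) :
  measurable_fun setT f -> (forall x, 0 <= f x)%E ->
  (\int[mu]_t (f (sin_atan t) * (hypot1 t ^- 3)%:E) =
   \int[mu]_s (f s * (\1_(`]-1, 1[%classic : set R) s)%:E))%E.
Proof.
move=> mf f0; have mh := measurable_hypot1; have mS := measurable_sin_atan.
pose D : set (measurableTypeR R) := `]-1, 1[%classic.
have mD : measurable D by exact: measurable_itv.
(* The inverse of [sin_atan] on []-1, 1[]. Elsewhere the root is 0 and the quotient takes its
   default value, which the restriction to [D] makes harmless. *)
pose phi (s : measurableTypeR R) : measurableTypeR R := s / Num.sqrt (1 - s ^+ 2).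
have mphi : measurable_fun setT phi by rewrite /phi; mfun.
have mw : measurable_fun setT (fun t : measurableTypeR R => hypot1 t ^- 3) by mfun.
have w0 (t : R) : 0 <= hypot1 t ^- 3 by rewrite invr_ge0 exprn_ge0// ltW// hypot1_gt0.
have [m1 m1E] := density_measure_ex mu mw w0.
have [m2 m2E] := image_measure_ex (mrestr mu mD) mphi.
have m12 : forall A, measurable A -> m1 A = m2 A.
  apply: measure_itv_oc_unique => [a b ab|a b].
    rewrite [LHS]m1E integral_hypot1V3// m2E.
    rewrite -[RHS]/(mu ((phi @^-1` `]a, b]) `&` D)).
    rewrite (_ : _ `&` _ = `](sin_atan a), (sin_atan b)]%classic).
      by rewrite lebesgue_measure_itv/= lte_fin sin_atan_lt ab -EFinB.
    have phiE s : -1 < s < 1 -> (a < phi s <= b) = (sin_atan a < s <= sin_atan b).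
      move=> s1; rewrite -[in RHS](sin_atanK s1) -/(phi s).
      by rewrite sin_atan_lt ![_ <= _]leNgt sin_atan_lt.
    apply/seteqP; split => s /=; rewrite /D/= !in_itv/=.
      by move=> [+ s1]; rewrite phiE.
    move=> sab; have s1 : -1 < s < 1.
      have /andP[as_ sb] := sab.
      have /andP[a1 _] := sin_atan_itv a; have /andP[_ b1] := sin_atan_itv b.
      by rewrite (lt_trans a1)//= (le_lt_trans sb).
    by rewrite phiE.
  have [ab|ba] := ltP a b; first by rewrite m1E integral_hypot1V3// ltry.
  by rewrite set_itv_ge ?measure0// bnd_simp -leNgt.
have fS0 : measurable_fun setT (f \o sin_atan) by exact: measurableT_comp mS.
rewrite -(ge0_integral_density (nu := m1) (f := f \o sin_atan))//.
transitivity (\int[m2]_t f (sin_atan t))%E.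
  by apply: eq_measure_integral => A mA _; exact: m12.
rewrite m2E ge0_integral_pushforward//= preimage_setT.
have m3E A : measurable A -> mrestr mu mD A = (\int[mu]_(x in A) (\1_D x)%:E)%E.
  by move=> mA; rewrite integral_indic// setIC.
rewrite (ge0_integral_density _ _ m3E)//; last first.
  exact: (measurableT_comp fS0 mphi).
apply: eq_integral => s _; rewrite indicE /D.
case: (boolP (s \in _)) => [|sD]; last by rewrite !mule0.
by rewrite inE /= in_itv/= => s1; rewrite sin_atanK.
by move=> x; exact: f0.
Qed.

End sin_atan_substitution.

(** * Lebesgue measure on the plane and on space *)

Lemma product_measure1_sigma_finite (R : realType) d1 d2 (T1 : measurableType d1)
    (T2 : measurableType d2) (m1 : {sigma_finite_measure set T1 -> \bar R})
    (m2 : {sigma_finite_measure set T2 -> \bar R}) :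
  sigma_finite setT (m1 \x m2)%E.
Proof.
have /sigma_finiteP[F [FT Fnd Foo]] := sigma_finiteT m1.
have /sigma_finiteP[G [GT Gnd Goo]] := sigma_finiteT m2.
exists (fun n => F n `*` G n) => [|n]; last first.
  have [[mF F_oo] [mG G_oo]] := (Foo n, Goo n); split; first exact: measurableX.
  by rewrite product_measure1E// lte_mul_pinfty// ge0_fin_numE.
apply/esym; rewrite -subTset => -[x y] _.
have [i _ Fx] : (\bigcup_n F n) x by rewrite -FT.
have [j _ Gy] : (\bigcup_n G n) y by rewrite -GT.
exists (maxn i j) => //; split => /=.
  exact: (subsetPset _ _ (Fnd _ _ (leq_maxl i j))).
exact: (subsetPset _ _ (Gnd _ _ (leq_maxr i j))).
Qed.

(* Named so that they carry their own sigma-finiteness instances: on products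
   the library only infers the one for subprobabilities. *)
Definition leb2 (R : realType) : set (R2 R) -> \bar R :=
  (lebesgue_measure \x lebesgue_measure)%E.

HB.instance Definition _ (R : realType) := Measure.on (@leb2 R).
HB.instance Definition _ (R : realType) :=
  Measure_isSigmaFinite.Build _ _ _ (@leb2 R)
    (product_measure1_sigma_finite (@lebesgue_measure R) (@lebesgue_measure R)).

Definition leb3 (R : realType) : set (R3 R) -> \bar R :=
  (@leb2 R \x lebesgue_measure)%E.

HB.instance Definition _ (R : realType) := Measure.on (@leb3 R).
HB.instance Definition _ (R : realType) :=
  Measure_isSigmaFinite.Build _ _ _ (@leb3 R)
    (product_measure1_sigma_finite (@leb2 R) (@lebesgue_measure R)).

Arguments leb2 {R}.
Arguments leb3 {R}.

Section tonelli.
Context {R : realType}.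
Local Notation mu := (@lebesgue_measure R).
Local Notation MR := (measurableTypeR R).

Lemma lebesgue3E (A : set (R3 R)) : lebesgue3 A = leb3 A.
Proof. by []. Qed.

Section two.
Variable f : R2 R -> \bar R.
Hypothesis mf : measurable_fun setT f.
Hypothesis f0 : (forall p, 0 <= f p)%E.

Lemma leb2_tonelli1 : (\int[leb2]_p f p = \int[mu]_x \int[mu]_y f (x, y))%E.
Proof. exact: (fubini_tonelli1 (m1 := mu) (m2 := mu) f mf f0). Qed.

Lemma leb2_tonelli2 : (\int[leb2]_p f p = \int[mu]_y \int[mu]_x f (x, y))%E.
Proof. exact: (fubini_tonelli2 (m1 := mu) (m2 := mu) f mf f0). Qed.

Lemma measurable_leb2_int1 : measurable_fun setT (fun x : MR => \int[mu]_y f (x, y))%E.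
Proof. exact: (measurable_fun_fubini_tonelli_F (m2 := mu) f mf f0). Qed.

Lemma measurable_leb2_int2 : measurable_fun setT (fun y : MR => \int[mu]_x f (x, y))%E.
Proof. exact: (measurable_fun_fubini_tonelli_G (m1 := mu) f mf f0). Qed.

End two.

Section three.
Variable f : R3 R -> \bar R.
Hypothesis mf : measurable_fun setT f.
Hypothesis f0 : (forall p, 0 <= f p)%E.

Lemma leb3_tonelli1 : (\int[leb3]_p f p = \int[leb2]_q \int[mu]_z f (q, z))%E.
Proof. exact: (fubini_tonelli1 (m1 := leb2) (m2 := mu) f mf f0). Qed.

Lemma leb3_tonelli2 : (\int[leb3]_p f p = \int[mu]_z \int[leb2]_q f (q, z))%E.
Proof. exact: (fubini_tonelli2 (m1 := leb2) (m2 := mu) f mf f0). Qed.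

Lemma measurable_leb3_int1 : measurable_fun setT (fun q : R2 R => \int[mu]_z f (q, z))%E.
Proof. exact: (measurable_fun_fubini_tonelli_F (m2 := mu) f mf f0). Qed.

Lemma measurable_leb3_int2 : measurable_fun setT (fun z : MR => \int[leb2]_q f (q, z))%E.
Proof. exact: (measurable_fun_fubini_tonelli_G (m1 := leb2) f mf f0). Qed.

End three.
End tonelli.

(** * Projections of the ball *)

Section gnomonic.
Context {R : realType}.
Local Notation mu := (@lebesgue_measure R).
Local Notation MR := (measurableTypeR R).

(** The map is triangular: with the first coordinate fixed, the shear [e] only translates the
    second, so two one-dimensional substitutions suffice. The case [e = 0] serves homotheties, the
    general case the Gram-Schmidt change of variables. *)
Lemma ge0_integral_affine2 (c c' e : R) (f : R2 R -> \bar R) : 0 < c -> 0 < c' ->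
  measurable_fun setT f -> (forall x, 0 <= f x)%E ->
  (\int[leb2]_p f (c * (p.1 : R), c' * (p.2 : R) + e * (p.1 : R))%R =
   ((c * c')^-1)%:E * \int[leb2]_p f p)%E.
Proof.
move=> c0 c'0 mf f0.
rewrite leb2_tonelli1; [|by mfun|by move=> p; exact: f0].
rewrite (leb2_tonelli1 mf f0)/=.
pose F x := (\int[mu]_y f (x, y))%E.
have mF : measurable_fun setT (F : MR -> _) := measurable_leb2_int1 mf f0.
have F0 x : (0 <= F x)%E by apply: integral_ge0 => y _; exact: f0.
transitivity (\int[mu]_x ((c'^-1)%:E * F (c * x + 0)%R))%E.
  apply: eq_integral => x _.
  rewrite (ge0_integral_affine (f := fun y => f (c * x, y)) (e * x) c'0)//.
    by rewrite addr0.
  by mfun.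
rewrite ge0_integralZl; last 4 first.
- exact: measurableT.
- by apply: (measurableT_comp mF); mfun.
- by move=> x _; exact: F0.
- by rewrite lee_fin invr_ge0 ltW.
rewrite (ge0_integral_affine (f := F) 0 c0)//.
by rewrite muleA -EFinM -invfM mulrC.
Qed.

Lemma eq_integral_but1 (f g : MR -> \bar R) (r : R) :
  measurable_fun setT f -> measurable_fun setT g ->
  (forall z, z != r -> f z = g z) -> (\int[mu]_z f z = \int[mu]_z g z)%E.
Proof.
move=> mf mg fg.
have mD : measurable ([set: MR] `\ r) by exact: measurableD.
have ef := integral_setD1 mD (measurable_funS measurableT (@subsetT _ _) mf).
have eg := integral_setD1 mD (measurable_funS measurableT (@subsetT _ _) mg).
rewrite -[LHS]ef -[RHS]eg; apply: eq_integral => z.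
by rewrite inE/= => -[_ /eqP]; exact: fg.
Qed.

Lemma integral_sqr_itv (a : R) : 0 < a ->
  (\int[mu]_(z in `[(- a)%R, a]) (z ^+ 2)%:E = (2 / 3 * a ^+ 3)%:E)%E.
Proof.
move=> a0.
have d (z : R) : is_derive z 1 (fun z : R => z ^+ 3 / 3) (z ^+ 2).
  by apply: is_derive_eq; rewrite /GRing.scale/=; field.
have ct : continuous (fun z : R => z ^+ 3 / 3).
  move=> t; apply/differentiable_continuous/derivable1_diffP.
  exact: (@ex_derive _ _ _ _ _ _ _ (d t)).
rewrite (@continuous_FTC2 _ _ (fun z => z ^+ 3 / 3))//.
- by rewrite -EFinB; congr _%:E; field.
- by rewrite gtrN.
- by apply: continuous_subspaceT => x; exact: exprn_continuous.
- split.
  + by move=> z _; exact: (@ex_derive _ _ _ _ _ _ _ (d z)).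
  + by apply: cvg_at_right_filter; exact: ct.
  + by apply: cvg_at_left_filter; exact: ct.
- by move=> z _; rewrite derive1E; exact: (@derive_val _ _ _ _ _ _ _ (d z)).
Qed.

Definition norm3 (p : R3 R) : R := Num.sqrt (p.1.1 ^+ 2 + p.1.2 ^+ 2 + p.2 ^+ 2).

Definition hypot2 (p : R2 R) : R := Num.sqrt (1 + p.1 ^+ 2 + p.2 ^+ 2).

(** The center is removed to match the half-open segments of [sphere_cone]. *)
Definition ball3 (p : R3 R) : R := (0 < norm3 p <= 1)%R%:R.

Lemma measurable_norm3 : measurable_fun [set: R3 R] norm3.
Proof. by rewrite /norm3; mfun. Qed.

Lemma measurable_hypot2 : measurable_fun [set: R2 R] hypot2.
Proof. by rewrite /hypot2; mfun. Qed.

Lemma measurable_ball3 : measurable_fun [set: R3 R] ball3.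
Proof. by have m3 := measurable_norm3; rewrite /ball3; mfun. Qed.

Lemma ball3_ge0 p : 0 <= ball3 p. Proof. by rewrite ler0n. Qed.

Lemma hypot2_gt0 p : 0 < hypot2 p.
Proof. by rewrite sqrtr_gt0 -addrA ltr_pwDl// addr_ge0// sqr_ge0. Qed.

Lemma norm3_scale (z : R) (p : R2 R) :
  norm3 (`|z| * (p.1 : R), `|z| * (p.2 : R), z) = `|z| * hypot2 p.
Proof.
rewrite /norm3/= !exprMn real_normK ?num_real//.
rewrite (_ : _ + _ = z ^+ 2 * (1 + p.1 ^+ 2 + p.2 ^+ 2)); last by ring.
by rewrite sqrtrM ?sqr_ge0// sqrtr_sqr.
Qed.

(** This factorization decouples the variables: it makes the weight [hypot2 ^- 3] a product of a
    function of [x] and a function of [y]. *)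
Lemma hypot2_scale (x y : R) : hypot2 (hypot1 y * x, y) = hypot1 y * hypot1 x.
Proof.
rewrite /hypot2/= exprMn sqr_hypot1.
rewrite (_ : _ + _ = (1 + y ^+ 2) * (1 + x ^+ 2)); last by ring.
by rewrite sqrtrM// addr_ge0// sqr_ge0.
Qed.

(* Substitute [(x, y, z) = (|z| t1, |z| t2, z)] and integrate over [z]. *)
Lemma ge0_integral_ball3_gnomonic (g : R2 R -> \bar R) :
  measurable_fun setT g -> (forall x, 0 <= g x)%E ->
  (\int[leb3]_p (g (p.1.1 / norm3 p, p.1.2 / norm3 p)%R * (ball3 p)%:E) =
   \int[leb2]_p (g (p.1 / hypot2 p, p.2 / hypot2 p)%R * (2 / 3 * hypot2 p ^- 3)%:E))%E.
Proof.
move=> mg g0; have mn := measurable_norm3; have mb := measurable_ball3.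
have mh := measurable_hypot2.
pose F (p : R3 R) := (g (p.1.1 / norm3 p, p.1.2 / norm3 p)%R * (ball3 p)%:E)%E.
have mF : measurable_fun setT F by rewrite /F; mfun.
have F0 p : (0 <= F p)%E by rewrite mule_ge0// lee_fin ball3_ge0.
pose G (p : R3 R) := (g (p.1.1 / hypot2 p.1, p.1.2 / hypot2 p.1)%R *
  (p.2 ^+ 2 * (`|p.2 : R| * hypot2 p.1 <= 1)%R%:R)%:E)%E.
have mh' : measurable_fun setT (fun p : R3 R => hypot2 p.1) by mfun.
have mG : measurable_fun setT G by rewrite /G; mfun.
have G0 p : (0 <= G p)%E by rewrite mule_ge0// lee_fin mulr_ge0 ?sqr_ge0.
rewrite (leb3_tonelli2 mF F0).
(* In the slice at height [z != 0], scaling both coordinates by [|z|] contributes the factor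
   [z ^+ 2]. The slice [z = 0], where the scaling degenerates, is one point of the outer
   integral. *)
have -> : (\int[mu]_z \int[leb2]_q F (q, z) = \int[mu]_z \int[leb2]_q G (q, z))%E.
  apply: (@eq_integral_but1 _ _ 0); first exact: measurable_leb3_int2.
    exact: measurable_leb3_int2.
  move=> z z0.
  have c0 : 0 < `|z| by rewrite normr_gt0.
  have := ge0_integral_affine2 (f := fun p => F (p, z)) 0 c0 c0.
  move=> /(_ _ _)/esym h.
  have {}h := h (measurableT_comp mF (pair2_measurable z)) (fun p => F0 (p, z)).
  have -> : (\int[leb2]_x F (x, z) = (`|z| * `|z|)%:E * \int[leb2]_p
     F ((`|z| * (p.1 : R), `|z| * (p.2 : R) + 0 * (p.1 : R))%R, z))%E.
    by rewrite -h muleA -EFinM divff ?mul1e// mulf_neq0// gt_eqF.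
  rewrite -ge0_integralZl; last 4 first.
  - exact: measurableT.
  - by apply: (measurableT_comp mF); mfun.
  - by move=> x _; exact: F0.
  - by rewrite lee_fin mulr_ge0.
  apply: eq_integral => p _; rewrite /F /G mul0r addr0 /ball3 norm3_scale/=.
  rewrite muleCA -EFinM; congr (g (_, _) * _%:E)%E.
  + by rewrite -mulf_div divff ?mul1r// gt_eqF.
  + by rewrite -mulf_div divff ?mul1r// gt_eqF.
  + by rewrite mulr_gt0 ?hypot2_gt0//= -normrM -expr2 ger0_norm ?sqr_ge0.
rewrite -(leb3_tonelli2 mG G0) (leb3_tonelli1 mG G0).
apply: eq_integral => p _; rewrite /G/=.
rewrite ge0_integralZl; last 4 first.
- exact: measurableT.
- by mfun.
- by move=> z _; rewrite lee_fin mulr_ge0 ?sqr_ge0.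
- exact: g0.
congr (_ * _)%E; have h0 := hypot2_gt0 p.
(* The constraint [|z| * hypot2 p <= 1] leaves [z] in a symmetric interval of half-length
   [(hypot2 p)^-1]; integrating [z ^+ 2] there produces [2 / 3 * hypot2 p ^- 3]. *)
rewrite -exprVn -integral_sqr_itv ?invr_gt0// [RHS]integral_mkcond.
apply: eq_integral => z _; rewrite epatch_indic/= indicE -EFinM; congr (_ * _)%:E.
by rewrite mem_setE in_itv/= -ler_norml -[in RHS](ler_pM2r h0) mulVf ?gt_eqF.
Qed.

(** Put [p.2 = y] and [p.1 = hypot1 y * x]. The arguments of [g] become [s = sin_atan x] and
    [sin_atan y * sqrt (1 - s ^+ 2)], and the Jacobian [hypot1 y] times [hypot2 ^- 3] leaves the
    weight [(1 + y ^+ 2)^-1] for [y] and exactly [ds] for [x]. *)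
Lemma ge0_integral_gnomonic (g : R2 R -> \bar R) :
  measurable_fun setT g -> (forall x, 0 <= g x)%E ->
  (\int[leb2]_p (g (p.1 / hypot2 p, p.2 / hypot2 p)%R * (2 / 3 * hypot2 p ^- 3)%:E) =
   (2 / 3)%:E * \int[mu]_y (((1 + y ^+ 2)^-1)%:E * \int[mu]_s
     (g (s, sin_atan y * Num.sqrt (1 - s ^+ 2))%R * (\1_(`]-1, 1[%classic : set R) s)%:E)))%E.
Proof.
move=> mg g0; have mh := measurable_hypot2.
have mh1 := @measurable_hypot1 R; have mS := @measurable_sin_atan R.
pose G (p : R2 R) := (g (p.1 / hypot2 p, p.2 / hypot2 p)%R * (2 / 3 * hypot2 p ^- 3)%:E)%E.
have mG : measurable_fun setT G by rewrite /G; mfun. 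
have G0 p : (0 <= G p)%E.
  by rewrite mule_ge0// lee_fin mulr_ge0// invr_ge0 exprn_ge0// ltW// hypot2_gt0.
rewrite (leb2_tonelli2 mG G0).
pose f (p : R2 R) := (g (p.1, sin_atan p.2 * Num.sqrt (1 - p.1 ^+ 2))%R)%E.
have mf : measurable_fun setT f by rewrite /f; mfun.
have mI : measurable_fun setT (\1_(`]-1, 1[%classic : set R) : MR -> R).
  by apply: measurable_indic; exact: measurable_itv.
have mfI : measurable_fun setT (fun p : R2 R => f p * (\1_(`]-1, 1[%classic : set R) p.1)%:E)%E.
  apply: emeasurable_funM => //; apply/measurable_EFinP.
  exact: (measurableT_comp mI measurable_fst).
have fI0 p : (0 <= f p * (\1_(`]-1, 1[%classic : set R) p.1)%:E)%E.
  by rewrite mule_ge0 /f ?lee_fin.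
have mF := measurable_leb2_int2 mfI fI0.
rewrite -ge0_integralZl; last 4 first.
- exact: measurableT.
- by apply: emeasurable_funM => //; mfun.
- move=> y _; rewrite mule_ge0//.
    by rewrite lee_fin invr_ge0 addr_ge0// sqr_ge0.
  by apply: integral_ge0 => x _; exact: (fI0 (x, y)).
- by rewrite lee_fin.
apply: eq_integral => y _.
have h0 := hypot1_gt0 y.
have := ge0_integral_affine (f := fun x => G (x, y)) 0 h0.
move=> /(_ (measurableT_comp mG (pair2_measurable y)) (fun x => G0 (x, y))) h.
have -> : (\int[mu]_x G (x, y) = (hypot1 y)%:E * \int[mu]_x G (hypot1 y * x + 0, y)%R)%E.
  by rewrite h muleA -EFinM divff ?mul1e// gt_eqF.
have mf' : measurable_fun setT (fun s : MR => f (s, y)) by mfun.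
rewrite -(ge0_integral_sin_atan mf' (fun s => g0 _)).
rewrite muleA -EFinM -sqr_hypot1 -!ge0_integralZl//; last 5 first.
- by mfun.
- by move=> x _; rewrite mule_ge0 ?g0// lee_fin invr_ge0 exprn_ge0// ltW// hypot1_gt0.
- by rewrite lee_fin mulr_ge0// invr_ge0 exprn_ge0// ltW.
- by apply: (measurableT_comp mG); mfun.
- by rewrite lee_fin ltW.
apply: eq_integral => t _; have t0 := hypot1_gt0 t.
rewrite /G /f/= addr0 hypot2_scale muleCA [RHS]muleCA -!EFinM.
rewrite sqrt_subr_sqr_sin_atan; congr (g (_, _) * _%:E)%E.
- by rewrite /sin_atan -mulf_div divff ?mul1r// gt_eqF.
- by rewrite /sin_atan; field; rewrite !gt_eqF.
- by field; rewrite !gt_eqF.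
Qed.

End gnomonic.

(** * Laws of one and of two coordinates of a normalized point of the ball *)

Section sphere_projections.
Context {R : realType}.
Local Notation mu := (@lebesgue_measure R).
Local Notation MR := (measurableTypeR R).
Local Notation I11 := (`]-1, 1[%classic : set R).

Lemma measurable_indic_I11 : measurable_fun setT (\1_I11 : MR -> R).
Proof. by apply: measurable_indic; exact: measurable_itv. Qed.

Lemma indic_I11E (s : R) : \1_I11 s = (-1 < s < 1)%R%:R :> R.
Proof. by rewrite indicE mem_setE in_itv. Qed.

Lemma I11_sqr (s : R) : (-1 < s < 1) = (s ^+ 2 < 1).
Proof.
by rewrite -ltr_norml -[s ^+ 2]real_normK ?num_real// expr_lt1.
Qed.

Lemma measurable_psi : measurable_fun setT (@psi R : MR -> R).
Proof. by rewrite /psi; apply: measurable_fun_ifT; mfun. Qed.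

Lemma psi_ge0 (x : R) : 0 <= psi x.
Proof.
rewrite /psi; case: ifP => // _.
by rewrite divr_ge0// mulr_ge0 ?sqrtr_ge0// mulr_ge0// pi_ge0.
Qed.

(** When the integrand ignores the second coordinate, the weight in [y] integrates to [pi] and the
    first coordinate keeps a constant density: Archimedes' theorem on zones of the sphere. *)
Lemma ge0_integral_ball3_slice (k : MR -> \bar R) :
  measurable_fun setT k -> (forall x, 0 <= k x)%E ->
  (\int[leb3]_p (k (p.1.1 / norm3 p)%R * (ball3 p)%:E) =
   (2 / 3 * pi)%:E * \int[mu]_s (k s * (\1_I11 s)%:E))%E.
Proof.
move=> mk k0; have mI := measurable_indic_I11.
have mk1 : measurable_fun setT (fun p : R2 R => k p.1) by mfun.
rewrite (ge0_integral_ball3_gnomonic mk1 (fun p => k0 _)).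
rewrite (ge0_integral_gnomonic mk1 (fun p => k0 _))/=.
rewrite (EFinM (2 / 3) pi) -muleA; congr (_ * _)%E.
rewrite ge0_integralZr; last 4 first.
- exact: measurableT.
- by mfun.
- by move=> x _; rewrite lee_fin invr_ge0 addr_ge0// sqr_ge0.
- by apply: integral_ge0 => s _; rewrite mule_ge0// lee_fin.
by rewrite integral_oneDsqrV.
Qed.

Lemma integral_ball3 : (\int[leb3]_p (ball3 p)%:E = (4 / 3 * pi)%:E :> \bar R)%E.
Proof.
have := @ge0_integral_ball3_slice (cst 1%E) (measurable_cst _) (fun _ => lee01).
under eq_integral do rewrite mul1e.
under [in RHS]eq_integral do rewrite mul1e.
move=> ->; rewrite integral_indic; [|exact: measurableT|exact: measurable_itv].
have h : mu I11 = 2%:E.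
  by rewrite lebesgue_measure_itv/= lte_fin gtrN// -EFinB; congr _%:E; ring.
by rewrite setIT [X in (_ * X)%E]h -EFinM; congr _%:E; field.
Qed.

(** With [w = sqrt (1 - s ^+ 2)] one has [1 - s ^+ 2 - (w * q) ^+ 2 = w ^+ 2 * (1 - q ^+ 2)]: along
    the chord of the disk at abscissa [s], [psi] is a rescaled arcsine density. *)
Lemma psi_scale (s q : R) : -1 < s < 1 ->
  psi (s ^+ 2 + (Num.sqrt (1 - s ^+ 2) * q) ^+ 2) * (2 * pi * Num.sqrt (1 - s ^+ 2)) =
  (Num.sqrt (1 - q ^+ 2))^-1 * \1_I11 q.
Proof.
rewrite I11_sqr => s1; have w0 : 0 < 1 - s ^+ 2 by rewrite subr_gt0.
have sw : 0 < Num.sqrt (1 - s ^+ 2) by rewrite sqrtr_gt0.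
rewrite exprMn sqr_sqrtr ?ltW// /psi indic_I11E I11_sqr.
have -> /= : 0 <= s ^+ 2 + (1 - s ^+ 2) * q ^+ 2.
  by rewrite addr_ge0 ?sqr_ge0// mulr_ge0 ?sqr_ge0// ltW.
rewrite -subr_gt0 (_ : 1 - _ = (1 - s ^+ 2) * (1 - q ^+ 2)); last by ring.
rewrite pmulr_rgt0// subr_gt0; case: ifPn => q1; last by rewrite mulr0 mul0r.
have q0 : 0 < Num.sqrt (1 - q ^+ 2) by rewrite sqrtr_gt0 subr_gt0.
rewrite mulr1 sqrtrM ?ltW//; move: (pi_gt0 R); move: (pi : R) => c c0; field.
by rewrite !gt_eqF.
Qed.

Lemma psi_out (s q : R) : ~~ (-1 < s < 1) -> psi (s ^+ 2 + q ^+ 2) = 0.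
Proof.
rewrite I11_sqr -leNgt => s1; rewrite /psi [_ < 1]ltNge.
by rewrite (le_trans s1) ?lerDl ?sqr_ge0// andbF.
Qed.

Lemma ge0_integral_ball3_disk (g : R2 R -> \bar R) :
  measurable_fun setT g -> (forall x, 0 <= g x)%E ->
  (\int[leb3]_p (g (p.1.1 / norm3 p, p.1.2 / norm3 p)%R * (ball3 p)%:E) =
   (4 / 3 * pi)%:E * \int[leb2]_p (g p * (psi (p.1 ^+ 2 + p.2 ^+ 2))%:E))%E.
Proof.
move=> mg g0; have mI := measurable_indic_I11; have mS := @measurable_sin_atan R.
have mpsi := measurable_psi.
rewrite (ge0_integral_ball3_gnomonic mg g0) (ge0_integral_gnomonic mg g0)/=.
rewrite (_ : 4 / 3 * pi = 2 / 3 * (2 * pi)); last by field.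
rewrite (EFinM (2 / 3) (2 * pi)) -muleA; congr (_ * _)%E.
have pi0 := pi_gt0 R.
pose K (p : R2 R) := (((1 + p.2 ^+ 2)^-1)%:E *
  (g (p.1, sin_atan p.2 * Num.sqrt (1 - p.1 ^+ 2))%R * (\1_I11 p.1)%:E))%E.
have mI1 : measurable_fun setT (fun p : R2 R => \1_I11 p.1 : R).
  exact: (measurableT_comp mI measurable_fst).
have mK : measurable_fun setT K by rewrite /K; mfun.
have c0 (y : R) : (0 <= ((1 + y ^+ 2)^-1)%:E :> \bar R)%E.
  by rewrite lee_fin invr_ge0 addr_ge0// sqr_ge0.
have K0 p : (0 <= K p)%E by rewrite /K !mule_ge0// lee_fin.
transitivity (\int[mu]_y \int[mu]_s K (s, y))%E.
  apply: eq_integral => y _; rewrite -ge0_integralZl//.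
  - by mfun.
  - by move=> s _; rewrite mule_ge0// lee_fin.
rewrite -(leb2_tonelli2 mK K0) (leb2_tonelli1 mK K0).
pose L (p : R2 R) := (g p * (psi (p.1 ^+ 2 + p.2 ^+ 2))%:E)%E.
have mL : measurable_fun setT L by rewrite /L; mfun.
have L0 p : (0 <= L p)%E by rewrite mule_ge0// lee_fin psi_ge0.
rewrite (leb2_tonelli1 mL L0).
rewrite -ge0_integralZl; last 4 first.
- exact: measurableT.
- exact: measurable_leb2_int1.
- by move=> x _; apply: integral_ge0 => y _; exact: L0.
- by rewrite lee_fin mulr_ge0// ltW.
apply: eq_integral => s _; rewrite /K/=.
have [s1|s1] := boolP (-1 < s < 1); last first.
  rewrite integral0_eq; last by move=> y _; rewrite indic_I11E (negbTE s1) !mule0.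
  rewrite integral0_eq ?mule0// => y _.
  by rewrite /L psi_out// mule0.
rewrite indic_I11E s1.
have w0 : 0 < Num.sqrt (1 - s ^+ 2) by rewrite sqrtr_gt0 subr_gt0 -I11_sqr.
set w := Num.sqrt (1 - s ^+ 2) in w0 *.
(* The weight [(1 + y ^+ 2)^-1] is [hypot1 y * hypot1 y ^- 3], and [hypot1 y] is
   [(sqrt (1 - q ^+ 2))^-1] at [q = sin_atan y]; the integral over [y] thus has the form required by
   [ge0_integral_sin_atan]. *)
pose f q := (g (s, q * w)%R * ((Num.sqrt (1 - q ^+ 2))^-1)%:E)%E.
have mf : measurable_fun setT (f : MR -> _) by rewrite /f; mfun.
have f0 q : (0 <= f q)%E by rewrite mule_ge0// lee_fin invr_ge0 sqrtr_ge0.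
transitivity (\int[mu]_y (f (sin_atan y) * (hypot1 y ^- 3)%:E))%E.
  apply: eq_integral => y _; have h0 := hypot1_gt0 y.
  rewrite /f sqrt_subr_sqr_sin_atan invrK -muleA mule1 muleC -EFinM.
  by congr (_ * _%:E)%E; rewrite -sqr_hypot1; field; rewrite gt_eqF.
rewrite (ge0_integral_sin_atan mf f0).
pose k q := (g (s, q) * (psi (s ^+ 2 + q ^+ 2) * (2 * pi * w))%:E)%E.
have mk : measurable_fun setT (k : MR -> _) by rewrite /k; mfun.
have k0 q : (0 <= k q)%E.
  by rewrite mule_ge0// lee_fin !mulr_ge0 ?psi_ge0// ltW.
transitivity (\int[mu]_q k (w * q + 0)%R)%E.
  apply: eq_integral => q _; rewrite /f /k addr0 psi_scale// -muleA -EFinM.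
  by rewrite mulrC.
rewrite (ge0_integral_affine 0 w0 mk k0) -!ge0_integralZl//; last 3 first.
- by rewrite /L; mfun.
- by rewrite lee_fin mulr_ge0// ltW.
- by rewrite lee_fin invr_ge0 ltW.
apply: eq_integral => q _; rewrite /k /L muleCA [RHS]muleCA -!EFinM.
by congr (_ * _%:E)%E; field; rewrite gt_eqF.
Qed.

End sphere_projections.

(** * Invariance under isometries *)

Section isometry_invariance.
Context {R : realType}.
Local Notation mu := (@lebesgue_measure R).
Local Notation MR := (measurableTypeR R).
Implicit Types (p q : R3 R).

Definition add3 p q : R3 R := (p.1.1 + q.1.1, p.1.2 + q.1.2, p.2 + q.2).
Definition sub3 p q : R3 R := (p.1.1 - q.1.1, p.1.2 - q.1.2, p.2 - q.2).
Definition opp3 p : R3 R := (- p.1.1, - p.1.2, - p.2).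

Lemma measurable_add3 : measurable_fun setT (fun x : R3 R * R3 R => add3 x.1 x.2).
Proof. by rewrite /add3; mfun. Qed.

Lemma measurable_sub3 : measurable_fun setT (fun x : R3 R * R3 R => sub3 x.1 x.2).
Proof. by rewrite /sub3; mfun. Qed.

Lemma measurable_opp3 : measurable_fun setT opp3.
Proof. by rewrite /opp3; mfun. Qed.

Lemma ge0_integral_shift (f : MR -> \bar R) (a : R) :
  measurable_fun setT f -> (forall x, 0 <= f x)%E ->
  (\int[mu]_x f (x + a)%R = \int[mu]_x f x)%E.
Proof.
move=> mf f0; have := ge0_integral_affine a ltr01 mf f0.
rewrite invr1 mul1e => <-; apply: eq_integral => x _; by rewrite mul1r.
Qed.

Lemma ge0_integral_leb2_shift (f : R2 R -> \bar R) (a b : R) :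
  measurable_fun setT f -> (forall x, 0 <= f x)%E ->
  (\int[leb2]_p f (p.1 + a, p.2 + b)%R = \int[leb2]_p f p)%E.
Proof.
move=> mf f0.
rewrite leb2_tonelli1; [|by mfun|by move=> p; exact: f0].
rewrite (leb2_tonelli1 mf f0)/=.
rewrite -(ge0_integral_shift a (measurable_leb2_int1 mf f0)); last first.
  by move=> x; apply: integral_ge0 => y _; exact: f0.
apply: eq_integral => x _.
apply: (ge0_integral_shift (f := fun y => f ((x + a)%R, y))) => //.
by mfun.
Qed.

Lemma ge0_integral_leb3_shift (f : R3 R -> \bar R) (t : R3 R) :
  measurable_fun setT f -> (forall x, 0 <= f x)%E ->
  (\int[leb3]_p f (add3 p t) = \int[leb3]_p f p)%E.
Proof.
move=> mf f0; rewrite /add3.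
rewrite leb3_tonelli2; [|by mfun|by move=> p; exact: f0].
rewrite (leb3_tonelli2 mf f0)/=.
rewrite -(ge0_integral_shift t.2 (measurable_leb3_int2 mf f0)); last first.
  by move=> x; apply: integral_ge0 => y _; exact: f0.
apply: eq_integral => z _.
have mz : measurable_fun setT (fun q : R2 R => f (q, (z + t.2)%R)) by mfun.
exact: (ge0_integral_leb2_shift t.1.1 t.1.2 mz (fun=> f0 _)).
Qed.

(* Both sides times the volume of the ball equal the double integral of
   [h (M x) * ball3 (y + M x)], computed in either order. *)
Lemma ge0_integral_isometry_opp (M M' : R3 R -> R3 R) (h : R3 R -> \bar R) :
  measurable_fun setT M -> cancel M' M ->
  (forall p q, M (sub3 p q) = sub3 (M p) (M q)) ->
  (forall p, norm3 (M p) = norm3 p) ->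
  measurable_fun setT h -> (forall x, 0 <= h x)%E ->
  (\int[leb3]_p h (M p) = \int[leb3]_p h (opp3 p))%E.
Proof.
move=> mM MK MB MN mh h0.
have mb := @measurable_ball3 R; have b0 := @ball3_ge0 R.
have ma := measurable_add3; have ms := measurable_sub3.
have mo := measurable_opp3.
have mbE : measurable_fun setT (fun p : R3 R => (ball3 p)%:E) by mfun.
have mhM : measurable_fun setT (fun p : R3 R => h (M p)) by mfun.
have bM p : ball3 (M p) = ball3 p by rewrite /ball3 MN.
have bE0 p : (0 <= (ball3 p)%:E)%E by rewrite lee_fin.
have V0 : (4 / 3 * pi : R) != 0 by rewrite gt_eqF// mulr_gt0 ?pi_gt0.
have H : ((4 / 3 * pi)%:E * \int[leb3]_p h (M p) =
    (4 / 3 * pi)%:E * \int[leb3]_p h (opp3 p))%E.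
  pose F (x : R3 R * R3 R) := (h (M x.1) * (ball3 (add3 x.2 (M x.1)))%:E)%E.
  have mF : measurable_fun setT F.
    have m1 : measurable_fun setT (fun x : R3 R * R3 R => add3 x.2 (M x.1)).
      apply: (measurableT_comp ma (g := fun x : R3 R * R3 R => (x.2, M x.1))).
      by mfun.
    have m2 : measurable_fun setT (fun x : R3 R * R3 R => ball3 (add3 x.2 (M x.1))).
      exact: measurableT_comp m1.
    rewrite /F; mfun.
  have F0 x : (0 <= F x)%E by rewrite mule_ge0.
  have T := fubini_tonelli (m1 := leb3) (m2 := leb3) F mF F0.
  transitivity (\int[leb3]_x \int[leb3]_y F (x, y))%E.
    rewrite muleC -ge0_integralZr; last 4 first.
    - exact: measurableT.
    - exact: mhM.
    - by move=> x _; exact: h0.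
    - by rewrite -integral_ball3; apply: integral_ge0.
    apply: eq_integral => x _; rewrite -integral_ball3.
    have e := ge0_integral_leb3_shift (M x) mbE bE0.
    rewrite -[X in (_ * X)%E]e -[LHS]ge0_integralZl.
    - by [].
    - exact: measurableT.
    - exact: (measurableT_comp mbE (measurableT_comp ma (pair2_measurable (M x)))).
    - by move=> y _; exact: bE0.
    - exact: h0.
  rewrite [LHS]T.
  pose G (x : R3 R * R3 R) := (h (sub3 (M x.1) x.2) * (ball3 x.1)%:E)%E.
  have mG : measurable_fun setT G.
    have m1 : measurable_fun setT (fun x : R3 R * R3 R => sub3 (M x.1) x.2).
      apply: (measurableT_comp ms (g := fun x : R3 R * R3 R => (M x.1, x.2))).
      by mfun.
    have m2 : measurable_fun setT (fun x : R3 R * R3 R => h (sub3 (M x.1) x.2)).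
      exact: measurableT_comp m1.
    rewrite /G; mfun.
  have G0 x : (0 <= G x)%E by rewrite mule_ge0.
  (* Translate [x] by [- M' y]: as [M (x - M' y) = M x - y], the argument of [h] becomes [M x - y]
     and that of the ball indicator [M x], which has the norm of [x]. *)
  transitivity (\int[leb3]_y \int[leb3]_x G (x, y))%E.
    apply: eq_integral => y _.
    rewrite -(ge0_integral_leb3_shift (opp3 (M' y))
      (measurableT_comp mF (pair2_measurable y)) (fun x => F0 (x, y))).
    apply: eq_integral => x _.
    have -> : add3 x (opp3 (M' y)) = sub3 x (M' y) by [].
    rewrite /F /G/= MB MK; congr (_ * _%:E)%E; rewrite -(bM x); congr ball3.
    rewrite /add3 /sub3/=; case: (M x) => -[x1 x2] x3 /=.
    by congr (_, _, _); rewrite addrC subrK.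
  rewrite -(fubini_tonelli (m1 := leb3) (m2 := leb3) G mG G0).
  rewrite -integral_ball3 -ge0_integralZr; last 4 first.
  - exact: measurableT.
  - exact: mbE.
  - by move=> x _; exact: bE0.
  - by apply: integral_ge0 => p _; exact: h0.
  apply: eq_integral => x _.
  (* Translating [y] by [M x] turns [h (M x - y)] into [h (- y)], free of [x]. *)
  rewrite -(ge0_integral_leb3_shift (M x)
    (measurableT_comp mG (pair1_measurable x)) (fun y => G0 (x, y))).
  rewrite -ge0_integralZl; last 4 first.
  - exact: measurableT.
  - exact: (measurableT_comp mh mo).
  - by move=> p _; exact: h0.
  - exact: bE0.
  apply: eq_integral => y _; rewrite /G/= muleC; congr (_ * h _)%E.
  rewrite /add3 /sub3 /opp3/=; case: (M x) => -[x1 x2] x3 /=.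
  by congr (_, _, _); rewrite opprD addrC subrK.
have V1 : ((4 / 3 * pi)^-1%:E * (4 / 3 * pi)%:E = 1%E :> \bar R)%E.
  by rewrite -EFinM mulVf.
rewrite -[LHS]mul1e -[RHS]mul1e -V1.
by rewrite -!muleA H.
Qed.

(** The reflection left by the previous lemma is removed by the same identity with [M] the identity
    map. *)
Lemma ge0_integral_isometry (M M' : R3 R -> R3 R) (h : R3 R -> \bar R) :
  measurable_fun setT M -> cancel M' M ->
  (forall p q, M (sub3 p q) = sub3 (M p) (M q)) ->
  (forall p, norm3 (M p) = norm3 p) ->
  measurable_fun setT h -> (forall x, 0 <= h x)%E ->
  (\int[leb3]_p h (M p) = \int[leb3]_p h p)%E.
Proof.
move=> mM MK MB MN mh h0; rewrite (ge0_integral_isometry_opp mM MK)//.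
by rewrite -(@ge0_integral_isometry_opp id id)//; mfun.
Qed.

End isometry_invariance.

(** * Projections of the uniform law on the sphere *)

Section uniform_projections.
Context {R : realType}.
Local Notation mu := (@lebesgue_measure R).
Local Notation MR := (measurableTypeR R).
Local Notation I11 := (`]-1, 1[%classic : set R).
Implicit Types (a b p : R3 R).

Definition dot3 a p : R := a.1.1 * p.1.1 + a.1.2 * p.1.2 + a.2 * p.2.

Definition cross3 a b : R3 R :=
  (a.1.2 * b.2 - a.2 * b.1.2, a.2 * b.1.1 - a.1.1 * b.2,
   a.1.1 * b.1.2 - a.1.2 * b.1.1).

Definition frame3 a b p : R3 R := (dot3 a p, dot3 b p, dot3 (cross3 a b) p).

Definition unit3 p : R3 R := (p.1.1 / norm3 p, p.1.2 / norm3 p, p.2 / norm3 p).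

Lemma measurable_dot3 a : measurable_fun setT (dot3 a : R3 R -> MR).
Proof. by rewrite /dot3; mfun. Qed.

Lemma measurable_unit3 : measurable_fun setT (unit3 : R3 R -> R3 R).
Proof. by have mn := @measurable_norm3 R; rewrite /unit3; mfun. Qed.

Lemma dot3_unit3 a p : dot3 a (unit3 p) = dot3 a p / norm3 p.
Proof. by rewrite /dot3 /unit3/=; ring. Qed.

Lemma norm3E p : norm3 p = Num.sqrt (dot3 p p).
Proof. by rewrite /norm3 /dot3 !expr2. Qed.

Section orthonormal_pair.
Variables a b : R3 R.
Hypotheses (a1 : dot3 a a = 1) (b1 : dot3 b b = 1) (ab : dot3 a b = 0).

Lemma measurable_frame3 : measurable_fun setT (frame3 a b : R3 R -> R3 R).
Proof.
have ma := measurable_dot3 a; have mb := measurable_dot3 b.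
have mc := measurable_dot3 (cross3 a b).
by rewrite /frame3; mfun.
Qed.

(* The square of the triple product is the Gram determinant. *)
Lemma norm3_frame3 p : norm3 (frame3 a b p) = norm3 p.
Proof.
rewrite !norm3E; congr Num.sqrt.
have gram : dot3 (cross3 a b) p ^+ 2 =
    dot3 a a * dot3 b b * dot3 p p + 2 * dot3 a b * dot3 b p * dot3 a p
    - dot3 a a * dot3 b p ^+ 2 - dot3 b b * dot3 a p ^+ 2
    - dot3 p p * dot3 a b ^+ 2 by rewrite /dot3 /cross3/=; ring.
rewrite [LHS](_ : _ = dot3 a p ^+ 2 + dot3 b p ^+ 2 + dot3 (cross3 a b) p ^+ 2).
  by rewrite gram a1 b1 ab; ring.
by rewrite [LHS]/dot3/= !expr2.
Qed.

(** The matrix of [frame3 a b] is orthogonal, so the transpose inverts it; its third row, the cross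
    product, is a unit vector by Lagrange's identity. *)
Lemma frame3K : cancel (fun p : R3 R =>
  (p.1.1 * a.1.1 + p.1.2 * b.1.1 + p.2 * (cross3 a b).1.1,
   p.1.1 * a.1.2 + p.1.2 * b.1.2 + p.2 * (cross3 a b).1.2,
   p.1.1 * a.2 + p.1.2 * b.2 + p.2 * (cross3 a b).2) : R3 R) (frame3 a b).
Proof.
have c1 : dot3 (cross3 a b) (cross3 a b) = dot3 a a * dot3 b b - dot3 a b ^+ 2.
  by rewrite /dot3 /cross3/=; ring.
move=> -[[x y] z]; rewrite /frame3 /=; congr (_, _, _).
- transitivity (x * dot3 a a + y * dot3 a b); first by rewrite /dot3/=; ring.
  by rewrite a1 ab; ring.
- transitivity (x * dot3 a b + y * dot3 b b); first by rewrite /dot3/=; ring.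
  by rewrite b1 ab; ring.
- transitivity (z * dot3 (cross3 a b) (cross3 a b)); first by rewrite /dot3/=; ring.
  by rewrite c1 a1 b1 ab; ring.
Qed.

Lemma ge0_integral_frame3 (h : R3 R -> \bar R) :
  measurable_fun setT h -> (forall x, 0 <= h x)%E ->
  (\int[leb3]_p (h (unit3 (frame3 a b p)) * (ball3 p)%:E) =
   \int[leb3]_p (h (unit3 p) * (ball3 p)%:E))%E.
Proof.
move=> mh h0; have mu3 := measurable_unit3; have mb := @measurable_ball3 R.
pose F p := (h (unit3 p) * (ball3 p)%:E)%E.
have mF : measurable_fun setT F.
  have m1 : measurable_fun setT (fun p => h (unit3 p)) by exact: measurableT_comp mu3.
  by rewrite /F; mfun.
have F0 p : (0 <= F p)%E by rewrite mule_ge0// lee_fin ball3_ge0.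
rewrite -[RHS](ge0_integral_isometry measurable_frame3 frame3K _ norm3_frame3 mF F0).
  by apply: eq_integral => p _; rewrite /F /ball3 norm3_frame3.
by move=> p q; rewrite /frame3 /sub3 /dot3/=; congr (_, _, _); ring.
Qed.

End orthonormal_pair.

(** Off the third axis, the horizontal part of [a] turned by a right angle and normalized is
    orthogonal to [a]; on that axis [(1, 0, 0)] is. *)
Lemma orthonormal_ex a : dot3 a a = 1 -> exists b, dot3 b b = 1 /\ dot3 a b = 0.
Proof.
case: a => -[x y] z; rewrite {1}/dot3/= => a1.
have [xy|xy] := eqVneq (x ^+ 2 + y ^+ 2) 0.
  exists (1, 0, 0); rewrite /dot3/=; split; first by ring.
  have /eqP : x ^+ 2 = 0.
    by apply/eqP; rewrite eq_le sqr_ge0 -xy lerDl sqr_ge0.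
  by rewrite sqrf_eq0 => /eqP ->; ring.
have s0 : 0 < x ^+ 2 + y ^+ 2 by rewrite lt_neqAle eq_sym xy addr_ge0// sqr_ge0.
have s0' : Num.sqrt (x ^+ 2 + y ^+ 2) ^+ 2 = x ^+ 2 + y ^+ 2 by rewrite sqr_sqrtr// ltW.
set s := Num.sqrt _ in s0'.
exists (- y / s, x / s, 0); rewrite /dot3/=; split; last by ring.
transitivity ((x ^+ 2 + y ^+ 2) / s ^+ 2); last by rewrite s0' divff.
have ? : s != 0 by rewrite /s gt_eqF// sqrtr_gt0.
by field.
Qed.

Section uniform.
Context d (T : measurableType d) (P : probability T R) (X : {RV P >-> R3 R}).
Hypothesis unifX : uniform_on_sphere X.

Lemma enorm_vec3 p : enorm (vec3 p) = norm3 p.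
Proof.
rewrite /enorm norm3E /dot mxE; congr Num.sqrt.
by rewrite !big_ord_recr big_ord0/= !mxE/= add0r.
Qed.

Lemma vec3_scale (r : R) p q :
  vec3 p = r *: vec3 q <-> p = (r * q.1.1, r * q.1.2, r * q.2).
Proof.
split=> [/matrixP pq|->].
  have := pq (Ordinal (isT : 0 < 3)%N) 0; have := pq (Ordinal (isT : 1 < 3)%N) 0.
  have := pq (Ordinal (isT : 2 < 3)%N) 0; rewrite !mxE/= => <- <- <-.
  by case: p {pq} => -[].
by apply/matrixP => i j; rewrite !mxE; case: i => -[|[|[|//]]] ? /=.
Qed.

Lemma norm3_scale_gt0 (r : R) p : 0 < r ->
  norm3 (r * p.1.1, r * p.1.2, r * p.2) = r * norm3 p.
Proof.
move=> r0; rewrite !norm3E [dot3 _ _](_ : _ = r ^+ 2 * dot3 p p).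
  by rewrite sqrtrM ?sqr_ge0// sqrtr_sqr gtr0_norm.
by rewrite /dot3/=; ring.
Qed.

(** A point [p] lies on a segment []0, x]] only for [x = unit3 p], with [r = norm3 p]. The product
    form gives the measurability of the cone and makes its volume the image under [unit3] of
    Lebesgue measure on the ball. *)
Lemma sphere_coneE (A : set (R3 R)) (p : R3 R) :
  (\1_(sphere_cone A) p : R) = \1_A (unit3 p) * ball3 p.
Proof.
rewrite !indicE /ball3 -natrM mulnb; congr (nat_of_bool _)%:R; apply/idP/idP.
  rewrite inE => -[r [x [r01 Ax x1 /vec3_scale px]]].
  have /andP[r0 r1] := r01.
  have np : norm3 p = r by rewrite px norm3_scale_gt0// -enorm_vec3 x1 mulr1.
  rewrite np r01 andbT inE /unit3 np px/= ![r * _ / r]mulrAC divff ?gt_eqF// !mul1r.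
  by move: Ax; case: x {x1 px} => -[].
rewrite inE => /andP[]; rewrite inE => Ap /andP[n0 n1].
have np : norm3 p != 0 by rewrite gt_eqF.
exists (norm3 p), (unit3 p); split => //; first by rewrite n0.
  rewrite enorm_vec3 -[RHS](mulVf np) -norm3_scale_gt0 ?invr_gt0//.
  by rewrite /unit3; congr (norm3 (_, _, _)); rewrite mulrC.
apply/vec3_scale; rewrite /unit3/= ![norm3 p * _]mulrC !divfK//.
by case: p {Ap n0 n1 np} => -[].
Qed.

(** The factor 3 of [sphere_measure] cancels in the quotient, leaving the volume of a cone over the
    volume [4 / 3 * pi] of the ball. *)
Lemma ge0_integral_uniform_on_sphere (f : R3 R -> \bar R) :
  measurable_fun setT f -> (forall x, 0 <= f x)%E ->
  (\int[distribution P X]_p f p =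
   ((4 / 3 * pi)^-1)%:E * \int[leb3]_p (f (unit3 p) * (ball3 p)%:E))%E.
Proof.
move=> mf f0; have mn := measurable_unit3; have mb := @measurable_ball3 R.
have V0 : 0 < 4 / 3 * pi :> R by rewrite mulr_gt0 ?pi_gt0.
have V1 : 0 <= (4 / 3 * pi : R)^-1 by rewrite invr_ge0 ltW.
have [m1 m1E] := density_measure_ex leb3 mb (@ball3_ge0 R).
have [m2 m2E] := image_measure_ex m1 mn.
have m2cone A : measurable A -> m2 A = lebesgue3 (sphere_cone A).
  move=> mA; rewrite m2E [LHS]m1E lebesgue3E.
  have mN : measurable (unit3 @^-1` A) by rewrite -[X in measurable X]setTI; exact: mn.
  have mC : measurable (sphere_cone A).
    apply/measurable_indicP.
    apply: (eq_measurable_fun (fun p => \1_(unit3 @^-1` A) p * ball3 p)).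
      by move=> p _; rewrite sphere_coneE.
    by apply: measurable_funM => //; exact: measurable_indic.
  rewrite -(setIT (sphere_cone A)) -integral_indic// integral_mkcond.
  apply: eq_integral => p _; rewrite sphere_coneE epatch_indic/=.
  by rewrite EFinM muleC.
have m2T : m2 setT = (4 / 3 * pi)%:E.
  by rewrite m2E [LHS]m1E preimage_setT integral_ball3.
have distE A : measurable A ->
    distribution P X A = mscale (NngNum V1) m2 A.
  move=> mA; rewrite [LHS](unifX mA) /sphere_measure -!m2cone// m2T -EFinM inver.
  by rewrite mulf_eq0 !gt_eqF//= muleAC -EFinM invfM mulrA divff// mul1r.
transitivity (\int[mscale (NngNum V1) m2]_p f p)%E.
  by apply: eq_measure_integral => A mA _; exact: distE.
rewrite ge0_integral_mscale// m2E ge0_integral_pushforward// preimage_setT.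
congr (_ * _)%E; apply: (ge0_integral_density mb (@ball3_ge0 R)) => //.
  exact: (measurableT_comp mf mn).
by move=> p; exact: f0.
Qed.

Lemma ge0_integral_uniform_slice a (k : MR -> \bar R) : dot3 a a = 1 ->
  measurable_fun setT k -> (forall x, 0 <= k x)%E ->
  (\int[distribution P X]_p k (dot3 a p) =
   (2^-1)%:E * \int[mu]_s (k s * (\1_I11 s)%:E))%E.
Proof.
move=> a1 mk k0; have [b [b1 ab]] := orthonormal_ex a1.
have ma := measurable_dot3 a.
have mka : measurable_fun setT (fun p => k (dot3 a p)) by exact: measurableT_comp ma.
rewrite (ge0_integral_uniform_on_sphere mka (fun=> k0 _)).
have mk1 : measurable_fun setT (fun p : R3 R => k p.1.1) by mfun.
have := ge0_integral_frame3 a1 b1 ab mk1 (fun=> k0 _).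
rewrite (ge0_integral_ball3_slice mk k0) => e.
rewrite [X in (_ * X)%E](_ : _ = (2 / 3 * pi)%:E * \int[mu]_s (k s * (\1_I11 s)%:E))%E.
  rewrite muleA -EFinM; congr (_%:E * _)%E.
  by move: (pi_gt0 R); move: (pi : R) => c c0; field; rewrite gt_eqF.
rewrite -e; apply: eq_integral => p _; rewrite dot3_unit3.
by rewrite /unit3/= norm3_frame3.
Qed.

Lemma ge0_integral_uniform_disk a b (g : R2 R -> \bar R) :
  dot3 a a = 1 -> dot3 b b = 1 -> dot3 a b = 0 ->
  measurable_fun setT g -> (forall x, 0 <= g x)%E ->
  (\int[distribution P X]_p g (dot3 a p, dot3 b p) =
   \int[leb2]_p (g p * (psi (p.1 ^+ 2 + p.2 ^+ 2))%:E))%E.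
Proof.
move=> a1 b1 ab mg g0.
have ma := measurable_dot3 a; have mb := measurable_dot3 b.
have mgab : measurable_fun setT (fun p => g (dot3 a p, dot3 b p)).
  apply: (measurableT_comp mg (g := fun p => (dot3 a p, dot3 b p))).
  exact: measurable_fun_pair.
rewrite (ge0_integral_uniform_on_sphere mgab (fun=> g0 _)).
have mg1 : measurable_fun setT (fun p : R3 R => g p.1) by mfun.
have := ge0_integral_frame3 a1 b1 ab mg1 (fun=> g0 _).
rewrite (ge0_integral_ball3_disk mg g0) => e.
rewrite [X in (_ * X)%E](_ : _ = (4 / 3 * pi)%:E *
    \int[leb2]_p (g p * (psi (p.1 ^+ 2 + p.2 ^+ 2))%:E))%E.
  rewrite muleA -EFinM mulVf ?mul1e//.
  by rewrite gt_eqF// mulr_gt0 ?pi_gt0.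
rewrite -e; apply: eq_integral => p _; rewrite !dot3_unit3.
by rewrite /unit3/= norm3_frame3.
Qed.

End uniform.
End uniform_projections.

(** * The conditional density *)

Section conditional_law.
Context {R : realType}.
Local Notation MR := (measurableTypeR R).
Implicit Types (m n r s A B C : R) (h : R2 R).

(** For positive [m], [n], [s], the density of [(m x, n (r x + s y))] when [(x, y)] has density
    [psi (x ^+ 2 + y ^+ 2)]. *)
Definition plane_density m n r s h : R :=
  (m * n * s)^-1 * psi ((h.1 / m) ^+ 2 + ((h.2 / n - r * (h.1 / m)) / s) ^+ 2).

(* The density with the Gram entries [A = |vRe|^2], [B = |vIm|^2],
   [C = vRe . vIm]. *)
Definition gram_density A B C h : R :=
  let m := Num.sqrt A in let n := Num.sqrt B in let r := C / (m * n) in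
  plane_density m n r (Num.sqrt (1 - r ^+ 2)) h.

Lemma plane_density_ge0 m n r s h : 0 <= m -> 0 <= n -> 0 <= s ->
  0 <= plane_density m n r s h.
Proof. by move=> *; rewrite mulr_ge0 ?psi_ge0// invr_ge0 !mulr_ge0. Qed.

Lemma gram_density_ge0 A B C h : 0 <= gram_density A B C h.
Proof. by rewrite plane_density_ge0 ?sqrtr_ge0. Qed.

Lemma gram_rho_lt1 A B C : 0 <= A -> 0 <= B -> C ^+ 2 < A * B ->
  [/\ 0 < Num.sqrt A, 0 < Num.sqrt B &
      0 < Num.sqrt (1 - (C / (Num.sqrt A * Num.sqrt B)) ^+ 2)].
Proof.
move=> A0 B0 CAB; have AB : 0 < A * B by rewrite (le_lt_trans _ CAB) ?sqr_ge0.
have A1 : 0 < A by rewrite lt_neqAle A0 andbT; apply: contraTneq AB => <-; rewrite mul0r ltxx.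
have B1 : 0 < B by rewrite lt_neqAle B0 andbT; apply: contraTneq AB => <-; rewrite mulr0 ltxx.
rewrite !sqrtr_gt0; split => //.
by rewrite expr_div_n exprMn !sqr_sqrtr// subr_gt0 ltr_pdivrMr// mul1r.
Qed.

Lemma dot_vec3 (p q : R3 R) : dot (vec3 p) (vec3 q) = dot3 p q.
Proof. by rewrite /dot mxE !big_ord_recr big_ord0/= !mxE/= add0r. Qed.

Lemma cond_densityE (z : R[i]) (v : 'cV[R[i]]_3) (a b : R3 R) :
  re_vec v = vec3 a -> im_vec v = vec3 b ->
  dot3 a b ^+ 2 < dot3 a a * dot3 b b ->
  cond_density z v = gram_density (dot3 a a) (dot3 b b) (dot3 a b) (C_to_R2 z).
Proof.
move=> aE bE ab.
have dge0 (p : R3 R) : 0 <= dot3 p p by rewrite /dot3 -!expr2 !addr_ge0 ?sqr_ge0.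
have [m0 n0 s0] := gram_rho_lt1 (dge0 a) (dge0 b) ab.
have eE p : enorm (vec3 p) = Num.sqrt (dot3 p p) by rewrite enorm_vec3 norm3E.
rewrite /cond_density /gram_density aE bE !eE dot_vec3.
set m := Num.sqrt (dot3 a a) in m0 s0 *.
set n := Num.sqrt (dot3 b b) in n0 s0 *; set r := _ / (m * n) in s0 *.
set s := Num.sqrt (1 - _) in s0 *.
set L : 'M[R]_(1 + 1) := block_mx _ _ _ _.
set x := complex.Re z / m; set y := (complex.Im z / n - r * x) / s.
have Lu : L \in unitmx.
  by rewrite unitmxE det_lblock !det_scalar1 mul1r unitfE gt_eqF.
(* The pair [x], [y] is the forward substitution for the triangular [L], so [invmx L] cancels
   without being computed. *)
have -> : col_mx x%:M (complex.Im z / n)%:M = L *m col_mx x%:M y%:M.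
  rewrite mul_block_col mul1mx mul0mx addr0 -!scalar_mxM -raddfD; congr (col_mx _ _%:M).
  by rewrite /y [s * _]mulrC divfK ?gt_eqF// addrC subrK.
rewrite mulKmx// /plane_density mul1r; congr (_ * psi _).
have -> : enorm (col_mx x%:M y%:M) = Num.sqrt (x ^+ 2 + y ^+ 2).
  rewrite /enorm /dot tr_col_mx mul_row_col !tr_scalar_mx -!scalar_mxM !mxE.
  by rewrite eqxx !mulr1n !expr2.
by rewrite sqr_sqrtr// addr_ge0 ?sqr_ge0.
Qed.

(** Gram-Schmidt: [a = m a'] and [b = n (r a' + s b')] with [a'], [b'] orthonormal, so the two
    projections are a triangular image, of determinant [m * n * s], of a pair with density [psi].
    Strict Cauchy-Schwarz makes [m], [n] and [s] positive. *)
Lemma ge0_integral_uniform_plane d (T : measurableType d) (P : probability T R)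
    (X : {RV P >-> R3 R}) (a b : R3 R) (g : R2 R -> \bar R) :
  uniform_on_sphere X -> dot3 a b ^+ 2 < dot3 a a * dot3 b b ->
  measurable_fun setT g -> (forall x, 0 <= g x)%E ->
  (\int[distribution P X]_o g (dot3 a o, dot3 b o) =
   \int[leb2]_h (g h * (gram_density (dot3 a a) (dot3 b b) (dot3 a b) h)%:E))%E.
Proof.
move=> unifX ab mg g0.
have dge0 (p : R3 R) : 0 <= dot3 p p by rewrite /dot3 -!expr2 !addr_ge0 ?sqr_ge0.
have [m0 n0 s0] := gram_rho_lt1 (dge0 a) (dge0 b) ab.
rewrite /gram_density; set m := Num.sqrt (dot3 a a) in m0 s0 *.
set n := Num.sqrt (dot3 b b) in n0 s0 *; set r := _ / (m * n) in s0 *.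
set s := Num.sqrt (1 - _) in s0 *.
have m2 : dot3 a a = m ^+ 2 by rewrite sqr_sqrtr.
have n2 : dot3 b b = n ^+ 2 by rewrite sqr_sqrtr.
have abE : dot3 a b = r * (m * n) by rewrite /r divfK// mulf_neq0// gt_eqF.
have s2 : s ^+ 2 = 1 - r ^+ 2.
  by rewrite sqr_sqrtr//; move: s0; rewrite sqrtr_gt0 => /ltW.
have mn : m != 0 by rewrite gt_eqF.
have nn : n != 0 by rewrite gt_eqF.
have sn : s != 0 by rewrite gt_eqF.
pose a' : R3 R := (a.1.1 / m, a.1.2 / m, a.2 / m).
pose b' : R3 R := ((b.1.1 / n - r * (a.1.1 / m)) / s,
  (b.1.2 / n - r * (a.1.2 / m)) / s, (b.2 / n - r * (a.2 / m)) / s).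
have aE o : dot3 a o = m * dot3 a' o by rewrite /dot3 /a'/=; field.
have bE o : dot3 b o = n * s * dot3 b' o + n * r * dot3 a' o.
  by rewrite /dot3 /b' /a'/=; field; rewrite mn nn sn.
have a'1 : dot3 a' a' = 1.
  transitivity (dot3 a a / m ^+ 2); first by rewrite /dot3 /a'/=; field.
  by rewrite m2 divff// expf_neq0.
have a'b' : dot3 a' b' = 0.
  transitivity ((dot3 a b / (m * n) - r * (dot3 a a / m ^+ 2)) / s).
    by rewrite /dot3 /a' /b'/=; field; rewrite mn nn sn.
  by rewrite abE m2; field; rewrite mn nn sn.
have b'1 : dot3 b' b' = 1.
  transitivity ((dot3 b b / n ^+ 2 - 2 * r * (dot3 a b / (m * n)) +
    r ^+ 2 * (dot3 a a / m ^+ 2)) / s ^+ 2).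
    by rewrite /dot3 /b'/=; field; rewrite mn nn sn.
  rewrite s2 n2 m2 abE.
  have sn2 : 1 - r ^+ 2 != 0 by rewrite -s2 expf_neq0.
  by field; rewrite mn nn sn2.
have mpsi := @measurable_psi R.
pose f h := (g h * (psi ((h.1 / m) ^+ 2 + ((h.2 / n - r * (h.1 / m)) / s) ^+ 2))%:E)%E.
have mf : measurable_fun setT f by rewrite /f; mfun.
have f0 h : (0 <= f h)%E by rewrite mule_ge0// lee_fin psi_ge0.
pose g' (p : R2 R) := g (m * p.1, n * s * p.2 + n * r * p.1).
have mg' : measurable_fun setT g' by rewrite /g'; mfun.
transitivity (\int[distribution P X]_o g' (dot3 a' o, dot3 b' o))%E.
  by apply: eq_integral => o _; rewrite aE bE.
rewrite (ge0_integral_uniform_disk unifX a'1 b'1 a'b' mg' (fun=> g0 _)).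
have ns0 : 0 < n * s by rewrite mulr_gt0.
transitivity (\int[leb2]_p f (m * (p.1 : R), n * s * (p.2 : R) + n * r * (p.1 : R))%R)%E.
  apply: eq_integral => p _; rewrite /f /g'/=; congr (_ * (psi _)%:E)%E.
  by field; rewrite mn nn sn.
rewrite (ge0_integral_affine2 (n * r) m0 ns0 mf f0) -ge0_integralZl; last 4 first.
- exact: measurableT.
- exact: mf.
- by move=> h _; exact: f0.
- by rewrite lee_fin invr_ge0 !mulr_ge0// ltW.
apply: eq_integral => h _; rewrite /f muleCA -EFinM /plane_density.
by rewrite [m * (n * s)]mulrA.
Qed.

End conditional_law.

(** * The channel *)

Section channel_law.
Context {R : realType}.
Local Notation mu := (@lebesgue_measure R).
Local Notation MR := (measurableTypeR R).
Variables (alpha : R[i]) (kappa : R) (U : R3 R).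
Hypotheses (alpha0 : alpha != 0) (kappa0 : 0 < kappa) (U1 : dot3 U U = 1).
Implicit Types (a b o : R3 R) (x : R).

(* Coefficients of the channel vector along [x u] and along [o - x u]. *)
Definition long_coef : R[i] := alpha * ((1 / kappa ^+ 3) +i* (1 / kappa ^+ 2)).
Definition trans_coef : R[i] :=
  alpha * ((1 / (2 * kappa) - 2^-1 * (1 / kappa ^+ 3)) +i* (- (2^-1 * (1 / kappa ^+ 2)))).

Local Notation p1 := (complex.Re long_coef).
Local Notation p2 := (complex.Im long_coef).
Local Notation q1 := (complex.Re trans_coef).
Local Notation q2 := (complex.Im trans_coef).

(** Multiplication by [alpha] is a plane similarity of determinant [|alpha|^2], and the two
    coefficients without [alpha] have determinant [- (2 * kappa ^+ 3)^-1]. *)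
Lemma coef_det_neq0 : p1 * q2 - p2 * q1 != 0.
Proof.
have k0 : kappa != 0 by rewrite gt_eqF.
rewrite /long_coef /trans_coef; case: alpha alpha0 => x y /= a0.
rewrite (_ : _ - _ = - ((x ^+ 2 + y ^+ 2) * ((2 * kappa ^+ 3)^-1))); last by field.
rewrite oppr_eq0 mulf_neq0 ?invr_eq0 ?mulf_neq0 ?expf_neq0//.
apply: contra a0; rewrite paddr_eq0 ?sqr_ge0// !sqrf_eq0 => /andP[/eqP -> /eqP ->].
by [].
Qed.

Definition real_part_vec o : R3 R := let x := dot3 U o in
  (p1 * x * U.1.1 + q1 * (o.1.1 - x * U.1.1),
   p1 * x * U.1.2 + q1 * (o.1.2 - x * U.1.2),
   p1 * x * U.2 + q1 * (o.2 - x * U.2)).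

Definition imag_part_vec o : R3 R := let x := dot3 U o in
  (p2 * x * U.1.1 + q2 * (o.1.1 - x * U.1.1),
   p2 * x * U.1.2 + q2 * (o.1.2 - x * U.1.2),
   p2 * x * U.2 + q2 * (o.2 - x * U.2)).

Lemma ord3P (Q : 'I_3 -> Prop) : Q (Ordinal (isT : 0 < 3)%N) ->
  Q (Ordinal (isT : 1 < 3)%N) -> Q (Ordinal (isT : 2 < 3)%N) -> forall i, Q i.
Proof.
move=> Q0 Q1 Q2 [[|[|[|//]]] i3].
- by rewrite (_ : Ordinal _ = Ordinal (isT : 0 < 3)%N)//; exact: val_inj.
- by rewrite (_ : Ordinal _ = Ordinal (isT : 1 < 3)%N)//; exact: val_inj.
- by rewrite (_ : Ordinal _ = Ordinal (isT : 2 < 3)%N)//; exact: val_inj.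
Qed.

(** With [x = dot3 U o], the near-field vector is [x U - (o - x U) / 2] and the far-field vector is
    [o - x U]; collecting coefficients gives [long_coef] and [trans_coef]. *)
Lemma channel_vecE o (i : 'I_3) : channel_vec alpha kappa (vec3 U) (vec3 o) i 0 =
  vec3 (real_part_vec o) i 0 +i* vec3 (imag_part_vec o) i 0.
Proof.
have k0 : kappa != 0 by rewrite gt_eqF.
have uo : vec3 U *m (vec3 U)^T *m vec3 o = dot3 U o *: vec3 U.
  rewrite -dot_vec3; move: (vec3 U) (vec3 o) => v w.
  by apply/matrixP => k l; rewrite -mulmxA !mxE big_ord1 (ord1 l) mulrC /dot !mxE.
rewrite /channel_vec /beta_NF /beta_FF !mulmxBl -scalemxAl uo mul1mx !mxE.
rewrite /real_part_vec /imag_part_vec /long_coef /trans_coef.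
case: alpha => x y; set X := dot3 U o.
move: i; apply: ord3P => /=; apply/eqP; rewrite eq_complex/=;
  by apply/andP; split; apply/eqP; field.
Qed.

Lemma re_channel_vec o : re_vec (channel_vec alpha kappa (vec3 U) (vec3 o)) =
  vec3 (real_part_vec o).
Proof. by apply/matrixP => i j; rewrite (ord1 j) [LHS]mxE channel_vecE. Qed.

Lemma im_channel_vec o : im_vec (channel_vec alpha kappa (vec3 U) (vec3 o)) =
  vec3 (imag_part_vec o).
Proof. by apply/matrixP => i j; rewrite (ord1 j) [LHS]mxE channel_vecE. Qed.

Lemma channelE a b : C_to_R2 (channel alpha kappa (vec3 U) (vec3 a) (vec3 b)) =
  (dot3 (real_part_vec a) b, dot3 (imag_part_vec a) b).
Proof.
rewrite /channel /dot mxE !big_ord_recr big_ord0/= !channel_vecE add0r.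
move: (real_part_vec a) (imag_part_vec a) => v w.
rewrite /C_to_R2 !mxE/= /dot3.
by congr (_, _); ring.
Qed.

Definition gram_rr x := x ^+ 2 * p1 ^+ 2 + (1 - x ^+ 2) * q1 ^+ 2.
Definition gram_ii x := x ^+ 2 * p2 ^+ 2 + (1 - x ^+ 2) * q2 ^+ 2.
Definition gram_ri x := x ^+ 2 * (p1 * p2) + (1 - x ^+ 2) * (q1 * q2).

(** The vectors [U] and [o - x U] are orthogonal with squared norms [1] and [1 - x ^+ 2], so [o]
    enters only through [x]. *)
Lemma gramE o : dot3 o o = 1 -> let x := dot3 U o in
  [/\ dot3 (real_part_vec o) (real_part_vec o) = gram_rr x,
      dot3 (imag_part_vec o) (imag_part_vec o) = gram_ii x &
      dot3 (real_part_vec o) (imag_part_vec o) = gram_ri x].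
Proof.
move=> o1 x.
have comb (p q p' q' : R) : dot3
    (p * x * U.1.1 + q * (o.1.1 - x * U.1.1), p * x * U.1.2 + q * (o.1.2 - x * U.1.2),
     p * x * U.2 + q * (o.2 - x * U.2))
    (p' * x * U.1.1 + q' * (o.1.1 - x * U.1.1), p' * x * U.1.2 + q' * (o.1.2 - x * U.1.2),
     p' * x * U.2 + q' * (o.2 - x * U.2)) =
    x ^+ 2 * (p * p') + (1 - x ^+ 2) * (q * q').
  transitivity (p * p' * x ^+ 2 * dot3 U U
    + (p * q' + q * p') * x * (dot3 U o - x * dot3 U U)
    + q * q' * (dot3 o o - 2 * x * dot3 U o + x ^+ 2 * dot3 U U)).
    by rewrite /dot3/=; ring.
  by rewrite U1 o1 -/x; ring.
by split; rewrite comb /gram_rr /gram_ii /gram_ri ?expr2.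
Qed.

(** The Gram determinant is [x ^+ 2 * (1 - x ^+ 2)] times the squared determinant of the
    coefficients. *)
Lemma gram_lt x : x != 0 -> x ^+ 2 < 1 -> gram_ri x ^+ 2 < gram_rr x * gram_ii x.
Proof.
move=> x0 x1; rewrite -subr_gt0.
rewrite (_ : _ - _ = x ^+ 2 * (1 - x ^+ 2) * (p1 * q2 - p2 * q1) ^+ 2).
  apply: mulr_gt0; last by rewrite exprn_even_gt0//= coef_det_neq0.
  by apply: mulr_gt0; rewrite ?subr_gt0// exprn_even_gt0.
by rewrite /gram_rr /gram_ii /gram_ri; ring.
Qed.

Definition channel_density x (h : R2 R) := gram_density (gram_rr x) (gram_ii x) (gram_ri x) h.

(** Pairs [(h, x)] form the type [R3], so the Tonelli lemmas for space also exchange the integrals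
    over [h] and [x]. *)
Lemma measurable_channel_density :
  measurable_fun setT (fun p : R3 R => channel_density p.2 p.1 : MR).
Proof.
have mpsi := @measurable_psi R.
by rewrite /channel_density /gram_density /plane_density /gram_rr /gram_ii /gram_ri; mfun.
Qed.

Lemma cond_density_at_channel (z : R[i]) x : x != 0 -> x ^+ 2 < 1 ->
  cond_density_at alpha kappa (vec3 U) z x = channel_density x (C_to_R2 z).
Proof.
move=> x0 x1; have [b [b1 Ub]] := orthonormal_ex U1.
pose w := Num.sqrt (1 - x ^+ 2).
have w2 : w ^+ 2 = 1 - x ^+ 2 by rewrite sqr_sqrtr// subr_ge0 ltW.
(* An explicit unit vector with [dot3 U o = x], replacing the one picked by [xget]. *)
pose o : R3 R := (x * U.1.1 + w * b.1.1, x * U.1.2 + w * b.1.2, x * U.2 + w * b.2).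
have Uo : dot3 U o = x.
  transitivity (x * dot3 U U + w * dot3 U b); first by rewrite /dot3/=; ring.
  by rewrite U1 Ub; ring.
have o1 : dot3 o o = 1.
  transitivity (x ^+ 2 * dot3 U U + 2 * x * w * dot3 U b + w ^+ 2 * dot3 b b).
    by rewrite /dot3/=; ring.
  by rewrite U1 Ub b1 w2; ring.
have e1 (p : R3 R) : dot3 p p = 1 -> enorm (vec3 p) = 1.
  by move=> p1'; rewrite enorm_vec3 norm3E p1' sqrtr1.
rewrite (@cond_density_atE _ _ _ _ _ _ (vec3 o)) ?e1// ?dot_vec3//.
have [grr gii gri] := gramE o1; rewrite Uo in grr gii gri.
rewrite (cond_densityE _ (re_channel_vec o) (im_channel_vec o)) ?grr ?gii ?gri//.
exact: gram_lt.
Qed.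

End channel_law.

(** * Joint law of the two orientations, exceptional orientations, and the law of the channel *)

Section assembly.
Context {R : realType}.
Local Notation mu := (@lebesgue_measure R).
Local Notation MR := (measurableTypeR R).
Local Notation I11 := (`]-1, 1[%classic : set R).

(** Independence makes the joint law agree with the product law on rectangles, which determine
    it. *)
Lemma independent_joint_law d d1 d2 (T : measurableType d) (T1 : measurableType d1)
    (T2 : measurableType d2) (P : probability T R) (X : {RV P >-> T1})
    (Y : {RV P >-> T2}) (W : set (T1 * T2)) :
  independent_RV X Y -> measurable W ->
  (P [set t | W (X t, Y t)] =
   \int[distribution P X]_a distribution P Y (xsection W a))%E.
Proof.
move=> indep mW.
have mXY : measurable_fun setT (fun t => (X t, Y t)) by exact: measurable_fun_pair.
have [nu nuE] := image_measure_ex P mXY.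
transitivity (nu W); first by rewrite nuE.
rewrite -(product_measure_unique (m1 := distribution P X) (m2 := distribution P Y))//.
by move=> A B mA mB; rewrite nuE; exact: indep.
Qed.

(** Measurability of [f] is carried through the induction, since each change at a single point needs
    it and only the values of [f] off [s] are known. *)
Lemma eq_integral_but_seq (s : seq R) (f g : MR -> \bar R) :
  measurable_fun setT g -> (forall x, x \notin s -> f x = g x) ->
  measurable_fun setT f /\ (\int[mu]_x f x = \int[mu]_x g x)%E.
Proof.
move=> mg; elim: s f => [|r s IHs] f fg.
  have -> : f = g by apply/funext => x; exact: fg.
  by [].
pose f' x := if x == r then g r else f x.
have [|mf' <-] := IHs f'.
  move=> x xs; rewrite /f'; case: eqVneq => [->//|xr].
  by apply: fg; rewrite inE negb_or xr.
have mf : measurable_fun setT f.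
  rewrite (_ : f = fun x => if x == r then f r else f' x).
    apply: measurable_fun_ifT => //.
    by apply: measurable_fun_eqr; mfun.
  by apply/funext => x; rewrite /f'; case: eqVneq => // ->.
split=> //; apply: (@eq_integral_but1 _ _ _ r) => // x xr.
by rewrite /f' (negbTE xr).
Qed.

(** The law of [X] only sees the points [unit3 p], where the exceptional set is described by
    [dot3 U o] alone; the uniform law of this coordinate on []-1, 1[] does not charge [0]. *)
Lemma uniform_generic_ae d (T : measurableType d) (P : probability T R)
    (X : {RV P >-> R3 R}) (U : R3 R) : uniform_on_sphere X -> dot3 U U = 1 ->
  {ae distribution P X, forall o,
    [/\ dot3 o o = 1, dot3 U o != 0 & dot3 U o ^+ 2 < 1]}.
Proof.
move=> unifX U1; have mU := measurable_dot3 U.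
pose good (x : MR) : bool := ~~ (x == 0) && (x ^+ 2 < 1).
have mgood : measurable_fun setT good.
  apply: measurable_and; last by mfun.
  by apply: measurable_neg; apply: measurable_fun_eqr; mfun.
pose bad (x : MR) : \bar R := ((~~ good x)%R%:R)%:E.
have mbad : measurable_fun setT bad.
  by apply/measurable_EFinP/measurable_nat_of_bool; exact: measurable_neg.
have bad0 x : (0 <= bad x)%E by rewrite lee_fin.
pose N : set (R3 R) := [set o | (dot3 o o == 1) && good (dot3 U o) = false].
have mN : measurable N.
  pose b (o : R3 R) : bool := (dot3 o o == 1) && good (dot3 U o).
  have mb : measurable_fun setT b.
    apply: measurable_and; last exact: (measurableT_comp mgood mU).
    by apply: measurable_fun_eqr; rewrite /dot3; mfun.
  have -> : N = setT `&` b @^-1` [set false] by rewrite setTI.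
  by apply: mb => //.
exists N; split => //; last first.
  move=> o /= Po; apply/negP; apply: contra_not Po => /andP[/eqP o1 /andP[x0 x1]].
  by split.
have mN1 : measurable_fun setT (fun o : R3 R => (\1_N o : R)%:E).
  by apply/measurable_EFinP; exact: measurable_indic.
transitivity (\int[distribution P X]_o (\1_N o)%:E)%E.
  by rewrite integral_indic// setIT.
transitivity (\int[distribution P X]_o bad (dot3 U o))%E.
  have mbU : measurable_fun setT (fun o => bad (dot3 U o)) by exact: measurableT_comp mU.
  rewrite (ge0_integral_uniform_on_sphere unifX mN1); last by move=> o; rewrite lee_fin.
  rewrite (ge0_integral_uniform_on_sphere unifX mbU (fun=> bad0 _)).
  congr (_ * _)%E; apply: eq_integral => p _; rewrite /ball3.
  have [/andP[p0 _]|] := boolP (0 < norm3 p <= 1); last by rewrite !mule0.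
  have p1 : dot3 (unit3 p) (unit3 p) = 1.
    have np : norm3 p != 0 by rewrite gt_eqF.
    transitivity (dot3 p p / norm3 p ^+ 2); first by rewrite /dot3 /unit3/=; field.
    have pp : 0 <= dot3 p p by rewrite /dot3 -!expr2 !addr_ge0 ?sqr_ge0.
    by move: np; rewrite norm3E => np; rewrite -[X in X / _](sqr_sqrtr pp) divff// expf_neq0.
  rewrite indicE /bad; congr (_%:R%:E * _)%E; congr nat_of_bool.
  by apply/idP/idP; rewrite inE /N/= p1 eqxx/=; [move=> ->|move/negbTE].
rewrite (ge0_integral_uniform_slice unifX U1 mbad bad0).
pose f s := (bad s * (\1_I11 s)%:E)%E.
have f0 x : x \notin [:: 0] -> f x = cst 0%E x.
  rewrite inE => x0; rewrite /f indic_I11E I11_sqr /bad /good x0/=.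
  by case: (x ^+ 2 < 1); rewrite ?mule0 ?mul0e.
have [_ ->] := eq_integral_but_seq (measurable_cst _) f0.
by rewrite integral0 mule0.
Qed.

End assembly.

Theorem proposition5 (d : measure_display) (T : measurableType d)
  (R : realType) (P : probability T R)
  (alpha : R[i]) (kappa : R) (u : 'cV[R]_3) (oT oR : {RV P >-> R3 R}) :
  alpha != 0 -> 0 < kappa -> enorm u = 1 ->
  uniform_on_sphere oT -> uniform_on_sphere oR -> independent_RV oT oR ->
  has_density P
    (fun t => channel alpha kappa u (vec3 (oT t)) (vec3 (oR t)))
    (fun h => ((2^-1)%:E *
       \int[lebesgue_measure]_(x in `[(-1)%R, 1%R])
         (cond_density_at alpha kappa u h x)%:E)%E).
Proof.
move=> alpha0 kappa0 u1 unifT unifR indep.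
have [U uE] : exists U : R3 R, u = vec3 U.
  exists (u (Ordinal (isT : 0 < 3)%N) 0, u (Ordinal (isT : 1 < 3)%N) 0,
    u (Ordinal (isT : 2 < 3)%N) 0).
  apply/matrixP => i j; rewrite mxE (ord1 j); move: i; exact: ord3P.
move: u1; rewrite uE => {u uE} /enorm1_dot; rewrite dot_vec3 => U1.
pose mu := @lebesgue_measure R.
pose chan (p : R3 R * R3 R) : R2 R :=
  (dot3 (real_part_vec alpha kappa U p.1) p.2, dot3 (imag_part_vec alpha kappa U p.1) p.2).
have mchan : measurable_fun setT chan.
  by rewrite /chan /real_part_vec /imag_part_vec /dot3/=; mfun.
pose K (x : R) (h : R2 R) := channel_density alpha kappa x h.
have mK := measurable_channel_density alpha kappa.
have K0 x h : 0 <= K x h by exact: gram_density_ge0.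
have mI := @measurable_indic_I11 R.
pose I11 : set R := `]-1, 1[%classic.
pose J (h : R2 R) := (\int[mu]_x ((K x h)%:E * (\1_I11 x)%:E))%E.
have mKI : measurable_fun setT (fun p : R3 R => (K p.2 p.1)%:E * (\1_I11 p.2)%:E)%E.
  have mI2 : measurable_fun setT (fun p : R3 R => \1_I11 p.2 : R).
    exact: (measurableT_comp mI measurable_snd).
  by mfun.
have KI0 (p : R3 R) : (0 <= (K p.2 p.1)%:E * (\1_I11 p.2)%:E)%E.
  by rewrite mule_ge0// lee_fin.
have mJ : measurable_fun setT J := measurable_leb3_int1 mKI KI0.
have J0 h : (0 <= J h)%E by apply: integral_ge0 => x _; exact: (KI0 (h, x)).
have fE (z : R[i]) : (\int[mu]_(x in `[(-1)%R, 1%R])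
    (cond_density_at alpha kappa (vec3 U) z x)%:E = J (C_to_R2 z))%E.
  rewrite integral_mkcond.
  (* The endpoints distinguish the closed interval from [I11]; there and at [0] the real and
     imaginary parts are dependent and [cond_density_at] is degenerate. *)
  have off x : x \notin [:: -1; 0; 1] ->
      ((fun x => (cond_density_at alpha kappa (vec3 U) z x)%:E) \_ `[(-1)%R, 1%R]) x =
      ((K x (C_to_R2 z))%:E * (\1_I11 x)%:E)%E.
    rewrite !inE !negb_or => /and3P[xN1 x0 x1].
    rewrite patchE mem_setE in_itv/= indic_I11E !le_eqVlt (negbTE x1) eq_sym (negbTE xN1)/=.
    have [xI|] := boolP (-1 < x < 1); last by rewrite mule0.
    by rewrite mule1 cond_density_at_channel// -I11_sqr.
  have mKz := measurableT_comp mKI (pair1_measurable (C_to_R2 z)).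
  by have [_ ->] := eq_integral_but_seq mKz off.
split.
- under eq_fun do rewrite channelE//.
  apply: (measurableT_comp mchan (g := fun t => (oT t, oR t))).
  exact: measurable_fun_pair.
- have JE (p : R2 R) : J (C_to_R2 (R2_to_C p)) = J p by case: p.
  under eq_fun do rewrite fE JE.
  apply: emeasurable_funM; first exact: measurable_cst.
  exact: mJ.
- move=> z; rewrite mule_ge0 ?lee_fin// integral_ge0// => x _.
  rewrite lee_fin /cond_density_at /cond_density mulr_ge0 ?psi_ge0//.
  by rewrite mul1r invr_ge0 !mulr_ge0 ?sqrtr_ge0.
move=> B mB.
pose W := chan @^-1` B.
have mW : measurable W by rewrite -[W]setTI; exact: mchan.
transitivity (P [set t | W (oT t, oR t)]).
  by congr (P _); apply/seteqP; split => t /=; rewrite channelE.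
rewrite (independent_joint_law indep mW).
pose G x := (\int[leb2]_h ((\1_B h)%:E * (K x h)%:E))%E.
have mB1 : measurable_fun setT (\1_B : R2 R -> R) by exact: measurable_indic.
have mBK : measurable_fun setT (fun p : R3 R => (\1_B p.1)%:E * (K p.2 p.1)%:E)%E.
  by mfun.
have BK0 (p : R3 R) : (0 <= (\1_B p.1)%:E * (K p.2 p.1)%:E)%E.
  by rewrite mule_ge0// lee_fin.
have mG : measurable_fun setT (G : measurableTypeR R -> _) := measurable_leb3_int2 mBK BK0.
have G0 x : (0 <= G x)%E by apply: integral_ge0 => h _; exact: (BK0 (h, x)).
(* For fixed [a], the section of [W] is the event that the two projections of [oR] fall in [B]. The
   planar density is available only for generic [a], hence an almost everywhere argument. *)
transitivity (\int[distribution P oT]_a G (dot3 U a))%E.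
  apply: ge0_ae_eq_integral.
  - exact: measurableT.
  - exact: measurable_fun_xsection.
  - exact: (measurableT_comp mG (measurable_dot3 U)).
  - by move=> a _; exact: measure_ge0.
  - by move=> a _; exact: G0.
  apply: filterS (uniform_generic_ae unifT U1) => a [a1 Ua0 Ua1] _.
  have [grr gii gri] := gramE alpha kappa U1 a1.
  have lt := gram_lt alpha0 kappa0 Ua0 Ua1.
  rewrite -grr -gii -gri in lt.
  have mB1E : measurable_fun setT (fun h : R2 R => (\1_B h : R)%:E) by mfun.
  have B0 (h : R2 R) : (0 <= (\1_B h : R)%:E)%E by rewrite lee_fin.
  have e := ge0_integral_uniform_plane unifR lt mB1E B0.
  rewrite grr gii gri in e; apply: (etrans _ e) => {e}.
  have mWa : measurable (xsection W a) by exact: measurable_xsection.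
  rewrite /= -[in LHS](setIT (xsection W a)) -integral_indic//.
  apply: eq_integral => o _; rewrite !indicE; congr (_%:R%:E); congr nat_of_bool.
  by rewrite mem_xsection; apply/idP/idP; rewrite !inE.
rewrite (ge0_integral_uniform_slice unifT U1 mG G0).
transitivity (\int[leb2]_(p in B) ((2^-1)%:E * J p))%E; last first.
  by apply: eq_integral => -[x y] _; rewrite fE.
rewrite [RHS]ge0_integralZl; last 4 first.
- exact: mB.
- exact: measurable_funTS.
- by move=> h _; exact: J0.
- by rewrite lee_fin.
congr (_ * _)%E; rewrite [RHS]integral_mkcond.
pose F (p : R3 R) := ((\1_B p.1)%:E * ((K p.2 p.1)%:E * (\1_I11 p.2)%:E))%E.
have mF : measurable_fun setT F by rewrite /F; mfun.
have F0 p : (0 <= F p)%E by rewrite !mule_ge0// lee_fin.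
(* [G] integrates over [h] first and [J] over [x] first; both sides are iterated integrals of
   [F]. *)
transitivity (\int[leb3]_p F p)%E.
  rewrite (leb3_tonelli2 mF F0); apply: eq_integral => x _.
  rewrite -ge0_integralZr; last 4 first.
  - exact: measurableT.
  - exact: (measurableT_comp mBK (pair2_measurable x)).
  - by move=> h _; exact: (BK0 (h, x)).
  - by rewrite lee_fin.
  by apply: eq_integral => h _; rewrite /F/= muleA.
rewrite (leb3_tonelli1 mF F0); apply: eq_integral => h _.
rewrite epatch_indic/= muleC -ge0_integralZl//.
- exact: (measurableT_comp mKI (pair1_measurable h)).
- by move=> x _; exact: (KI0 (h, x)).
Qed.
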